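(* Let $d\ge 1$ be the dimension, and let $c:\mathbb{N}\to[0,+\infty)$ be a rate function with $c(0)=0$ and $\inf\{c(n):n>0\}>0$. Assume that the following two conditions hold: (LG) $\sup_{k\in\mathbb{N}}|c(k+1)-c(k)|=:a_1<+\infty$; (M) there exist $k_0>0$ and $a_2>0$ such that $c(k)-c(j)\ge a_2$ for any $j\in\mathbb{N}$ and $k\ge j+k_0$. Let $\Lambda=[0,L]^d\cap\mathbb{Z}^d$. Then there exists a constant $C(L)>0$, that may only depend on $a_1$, $a_2$, the dimension $d$ and $L$, such that for every choice of $N\ge 1$, $L\ge 2$ and $f:\Omega_\Lambda\to\mathbb{R}$, $f>0$, we have $$\mathrm{Ent}_{\nu_\Lambda^N}(f)\le C(L)\,\mathcal{E}_{\nu_\Lambda^N}\bigl(\sqrt f,\sqrt f\bigr).$$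
   Context: $\mathbb{N}=\{0,1,2,\dots\}$. For $\Lambda\subset\mathbb{Z}^d$ finite and nonempty, $\Omega_\Lambda=\mathbb{N}^\Lambda$ is the configuration space, and for $\eta\in\Omega_\Lambda$, $\overline\eta_\Lambda=\sum_{x\in\Lambda}\eta_x$ is the total number of particles. $\delta^x$ is the configuration with one particle at $x$ and no other particle. For $x,y\in\Lambda$, $\partial_{xy}f(\eta)=f(\eta-\delta^x+\delta^y)-f(\eta)$ (defined when $\eta_x\ge 1$; since $c(0)=0$, a product $c(\eta_x)\cdot(\cdots)$ is read as $0$ when $\eta_x=0$). Write $c(0)!=1$ and $c(k)!=c(1)\cdots c(k)$ for $k>0$. The canonical measure $\nu_\Lambda^N$ is the probability measure on $\{\eta\in\Omega_\Lambda:\overline\eta_\Lambda=N\}$ given by $\nu_\Lambda^N[\{\eta\}]=\frac{1}{Z_\Lambda^N}\prod_{x\in\Lambda}\frac{1}{c(\eta_x)!}$, where $Z_\Lambda^N$ is the normalization factor. For a probability measure $\mu$, $\mu[f]=\int f\,d\mu$. The entropy is $\mathrm{Ent}_\mu(f)=\mu[f\log f]-\mu[f]\log\mu[f]$ for $f\ge 0$ (with $0\log 0=0$). The Dirichlet form of the zero-range process in $\Lambda$ with $N$ particles is $$\mathcal{E}_{\nu_\Lambda^N}(f,g)=\frac12\sum_{x\in\Lambda}\ \sum_{y\in\Lambda:\,|x-y|=1}\nu_\Lambda^N\bigl[c(\eta_x)\,\partial_{xy}f(\eta)\,\partial_{xy}g(\eta)\bigr].$$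
   Formalization: The constant C(L) may depend also on k_0 and on inf{c(n): n>0}, besides a_1, a_2, d and L; with a_1, a_2, d and L alone the uniform claim fails, e.g. for c(0)=0, c(n)=n-1+e with e small and N=1. *)

(* Defs.v *)
From HB Require Import structures.
From mathcomp Require Import all_boot all_order all_algebra finmap.
From mathcomp Require Import boolp classical_sets functions cardinality fsbigop reals exp.

Set Implicit Arguments.
Unset Strict Implicit.
Unset Printing Implicit Defensive.

Import Order.TTheory GRing.Theory Num.Theory.

Local Open Scope classical_set_scope.
Local Open Scope fset_scope.
Local Open Scope ring_scope.

(* The library norm on matrices is the sup norm, for which diagonal neighbours
   are also at distance 1; nearest neighbours in Z^d need the l1 distance (on
   Z^d, l1 distance 1 is the same as Euclidean distance 1). *)
Definition dist1 (d : nat) (x y : 'rV[int]_d) : int :=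
  \sum_(i < d) `|x 0 i - y 0 i|.

(* [0, L]^d, with L.+1 sites in each direction *)
Definition cube (d L : nat) : {fset 'rV[int]_d} :=
  [fset \row_(i < d) (v i : nat)%:Z | v : {ffun 'I_d -> 'I_L.+1} in predT].

Lemma in_cube (d L : nat) (x : 'rV[int]_d) :
  (x \in cube d L) = [forall i, 0 <= x 0 i <= L%:Z].
Proof.
apply/imfsetP/forallP => [[v _ ->] i|x_in].
  by rewrite mxE lez_nat /= -ltnS ltn_ord.
have xE i : exists k : 'I_L.+1, x 0 i == (k : nat)%:Z.
  have /andP[x0 xL] := x_in i.
  have kL : (`|x 0%R i| < L.+1)%N by rewrite ltnS -lez_nat gez0_abs.
  by exists (Ordinal kL); rewrite /= gez0_abs.
exists [ffun i => xchoose (xE i)]; first by [].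
by apply/rowP => i; rewrite mxE ffunE; apply/eqP/(xchooseP (xE i)).
Qed.

Section ZeroRange.
Context (R : realType) (d : nat) (Lam : {fset 'rV[int]_d}).

Definition config := {ffun Lam -> nat}.

Definition particles (eta : config) : nat := (\sum_(x : Lam) eta x)%N.

Definition configs_with (N : nat) : set config :=
  [set eta | particles eta = N].

(* eta - delta^x + delta^y; the subtraction is truncated, which is only
   visible when [eta x = 0] *)
Definition move (x y : Lam) (eta : config) : config :=
  [ffun z => (eta z - (z == x) + (z == y))%N].

Definition grad (x y : Lam) (f : config -> R) (eta : config) : R :=
  f (move x y eta) - f eta.

Variable c : nat -> R.

Definition rate_fact (k : nat) : R := \prod_(1 <= i < k.+1) c i.

Definition weight (eta : config) : R := \prod_(x : Lam) (rate_fact (eta x))^-1.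

Definition partition_function (N : nat) : R :=
  \sum_(eta \in configs_with N) weight eta.

Definition canonical_pmf (N : nat) (eta : config) : R :=
  (partition_function N)^-1 * weight eta.

Definition canonical_mean (N : nat) (f : config -> R) : R :=
  \sum_(eta \in configs_with N) canonical_pmf N eta * f eta.

Definition dirichlet (N : nat) (f g : config -> R) : R :=
  2^-1 * \sum_(x : Lam) \sum_(y : Lam | dist1 (val x) (val y) == 1)
    canonical_mean N (fun eta => c (eta x) * grad x y f eta * grad x y g eta).

End ZeroRange.

(* Entropy with respect to the probability measure whose expectation is [E];
   [ln 0 = 0] in the library, so that 0 log 0 = 0. *)
Definition entropy (R : realType) (T : Type) (E : (T -> R) -> R) (f : T -> R) : R :=
  E (fun x => f x * ln (f x)) - E f * ln (E f).

(* The sums over [configs_with] are taken over the support and would be 0 by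
   convention if it were infinite; it never is. *)
Lemma finite_configs_with (d : nat) (Lam : {fset 'rV[int]_d}) (N : nat) :
  finite_set (@configs_with d Lam N).
Proof.
pose F (g : {ffun Lam -> 'I_N.+1}) : config Lam := [ffun x => nat_of_ord (g x)].
apply: (@sub_finite_set _ _ (F @` setT)); last exact/finite_image/finite_finset.
move=> eta /= etaN; exists [ffun x => inord (eta x)] => //.
apply/ffunP => x; rewrite !ffunE inordK// ltnS -etaN /particles.
by rewrite (bigD1 x)//= leq_addr.
Qed.

Lemma weight_gt0 (R : realType) (d : nat) (Lam : {fset 'rV[int]_d})
    (c : nat -> R) (eta : config Lam) :
  (forall n, (0 < n)%N -> 0 < c n) -> 0 < weight c eta.
Proof.
move=> c0; apply: prodr_gt0 => x _; rewrite invr_gt0 /rate_fact.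
by rewrite big_nat; apply: prodr_gt0 => i /andP[i0 _]; exact: c0.
Qed.

Lemma partition_function_gt0 (R : realType) (d : nat) (Lam : {fset 'rV[int]_d})
    (c : nat -> R) (N : nat) :
  Lam != fset0 -> (forall n, (0 < n)%N -> 0 < c n) ->
  0 < partition_function Lam c N.
Proof.
move=> /fset0Pn[z zL] c0.
have Wge0 eta : 0 <= weight c eta :> R by apply/ltW/weight_gt0.
pose e : config Lam := [ffun x => if x == [` zL] then N else 0%N].
have eN : configs_with N e.
  rewrite /configs_with /= /particles (bigD1 [` zL])//= ffunE eqxx.
  by rewrite big1 ?addn0// => i /negPf ni; rewrite ffunE ni.
rewrite /partition_function fsbig_finite/=; last exact: finite_configs_with.
rewrite (big_fsetD1 e)/=; last by rewrite in_fset_set ?inE//; exact: finite_configs_with.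
by apply: ltr_pwDl; [exact: weight_gt0|exact: sumr_ge0].
Qed.

Lemma canonical_mean1 (R : realType) (d : nat) (Lam : {fset 'rV[int]_d})
    (c : nat -> R) (N : nat) :
  Lam != fset0 -> (forall n, (0 < n)%N -> 0 < c n) ->
  canonical_mean (Lam := Lam) c N (fun=> 1) = 1.
Proof.
move=> L0 c0; have Z0 := partition_function_gt0 N L0 c0.
have fin := @finite_configs_with d Lam N.
rewrite /canonical_mean fsbig_finite//=.
under eq_bigr do rewrite mulr1.
rewrite -big_distrr/= -fsbig_finite//=.
by rewrite mulVf// gt_eqF.
Qed.

(* Main.v *)
Require Import Defs.
From HB Require Import structures.
From mathcomp Require Import all_boot all_order all_algebra finmap.
From mathcomp Require Import boolp classical_sets functions cardinality fsbigop reals exp.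
From mathcomp Require Import sequences ring lra zify.

Set Implicit Arguments.
Unset Strict Implicit.
Unset Printing Implicit Defensive.

Import Order.TTheory GRing.Theory Num.Theory.
Local Open Scope classical_set_scope.
Local Open Scope ring_scope.

(** The constant may depend on the number of sites, so the whole difficulty is
    uniformity in the number [N] of particles.  The proof goes through the
    complete graph on the sites and an induction on their number.

    Smoothing.  Replacing [c] by its geometric mean over a centred window longer
    than [k0] turns (M) into a uniform lower bound on the increments of the rate,
    and changes the weights [1 / c(k)!] only by a bounded factor, because the
    second differences of [ln c(k)!] are bounded ([rate_smoothing]).  The entropy
    and the Dirichlet form then change by bounded factors
    ([wentropy_perturb]), so one may assume [del <= c(k+1) - c(k) <= a].

    Lumping.  For such rates the measures with [M] and [M + 1] particles are
    coupled by adding a single particle ([monotone_coupling]).  Consequently a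
    group of sites behaves like one site, of weight its partition function, and
    the rate of that site again has increments between two positive constants
    ([convolution_rated], [seq_partition_rated]).

    Induction ([complete_graph_lsi]).  The entropy is the mean of the entropy
    given the occupation of the first site, to which the induction hypothesis
    applies, plus the entropy of the conditional mean [F], a function of that
    occupation alone.  The law of the latter is a birth and death chain on
    [0, N]; its logarithmic Sobolev inequality bounds the second term by a sum of
    [(sqrt F(k+1) - sqrt F(k))^2].  As [(x, y) -> (sqrt x - sqrt y)^2] is jointly
    convex, the coupling bounds this by the Dirichlet form of the jumps between
    the first site and the others ([sqrt_mean_dist]).

    One dimension ([birth_death_lsi]).  The difference [phi] of the death and
    birth rates has increments of order one and satisfies an exact integration
    by parts formula ([stein]).  That formula gives a Poincare inequality
    ([poincare]), the bound [E (phi^2 h^2) <= C N (E h^2 + dir h)]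
    ([phi2_bound]) and, when [E h^2 = 1], the uniform bound
    [m h^2 <= C (1 + dir h) / sqrt N] ([density_bound]).  Since
    [- ln m <= ln N / 2 + C (1 + phi^2 / N)] ([mass_lower_bound]), writing
    [h^2 = (m h^2) / m] in the entropy yields
    [Ent (h^2) <= C (E h^2 + dir h)], and the Poincare inequality removes the
    term [E h^2].

    Finally the complete graph is compared with the nearest neighbour graph of
    the cube along shortest paths, configuration by configuration
    ([cube_path_bound]). *)

(** * Entropy and means under finite weights *)

Section Means.
Context (R : realType).

Lemma cov_pairs (T : Type) (r : seq T) (m x y : T -> R) :
  \sum_(i <- r) m i = 1 ->
  \sum_(i <- r) \sum_(j <- r) m i * m j * ((x i - x j) * (y i - y j)) =
  2 * (\sum_(i <- r) m i * (x i * y i) -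
       (\sum_(i <- r) m i * x i) * (\sum_(i <- r) m i * y i)).
Proof.
move=> m1.
pose E g := \sum_(i <- r) m i * g i.
have inner i : \sum_(j <- r) m i * m j * ((x i - x j) * (y i - y j)) =
    m i * (x i * y i) - E y * (m i * x i) - E x * (m i * y i)
    + E (fun j => x j * y j) * m i.
  transitivity (\sum_(j <- r) (m i * (x i * y i) * m j - m i * x i * (m j * y j)
      - m i * y i * (m j * x j) + m i * (m j * (x j * y j)))).
    by apply: eq_bigr => j _; ring.
  rewrite big_split/= !sumrB -!big_distrr/= m1 /E; ring.
under eq_bigr do rewrite inner.
rewrite big_split/= !sumrB -!big_distrr/= m1 /E; ring.
Qed.

(** The entropy of [f] under the measure with weights [W], for a measure that
    need not have mass one; it is homogeneous in [W]. *)
Definition wentropy (T : Type) (r : seq T) (W f : T -> R) : R :=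
  \sum_(x <- r) W x * (f x * ln (f x)) -
  (\sum_(x <- r) W x * f x) *
    ln ((\sum_(x <- r) W x * f x) / \sum_(x <- r) W x).

Lemma ln_leB1 (x : R) : 0 < x -> ln x <= x - 1.
Proof. by move=> x0; have := @le_ln1Dx R (x - 1); rewrite [1 + _]addrC subrK; apply; lra. Qed.

Lemma xlnx_ge (x t : R) : 0 < x -> 0 < t -> 0 <= x * ln (x / t) - x + t.
Proof.
move=> x0 t0.
have : ln (t / x) <= t / x - 1 by apply/ln_leB1/divr_gt0.
rewrite !ln_div ?posrE// => h.
have : x * (ln t - ln x) <= x * (t / x - 1) by rewrite ler_pM2l.
rewrite !mulrBr [x * (t/x)]mulrC divfK ?gt_eqF//; lra.
Qed.

(** The variational form of the entropy: the right-hand side is minimal when [t]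
    is the mean ([wentropy_ref]).  Its integrand is nonnegative ([xlnx_ge]), so
    that, unlike the entropy itself, it is monotone in the weights. *)
Lemma wentropy_le_ref (T : Type) (r : seq T) (W f : T -> R) (t : R) :
  0 < \sum_(x <- r) W x -> 0 < \sum_(x <- r) W x * f x -> 0 < t ->
  (forall x, 0 < f x) ->
  wentropy r W f <= \sum_(x <- r) W x * (f x * ln (f x / t) - f x + t).
Proof.
move=> Z0 S0 t0 f0.
have -> : \sum_(x <- r) W x * (f x * ln (f x / t) - f x + t) =
   \sum_(x <- r) W x * (f x * ln (f x))
   - (ln t + 1) * (\sum_(x <- r) W x * f x) + t * \sum_(x <- r) W x.
  rewrite !big_distrr/= -sumrB -big_split/=; apply: eq_bigr => x _.
  rewrite ln_div ?posrE//; ring.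
rewrite /wentropy; set S := \sum_(x <- r) W x * f x in S0 *.
set Z := \sum_(x <- r) W x in Z0 *.
have := @xlnx_ge (S / Z) t (divr_gt0 S0 Z0) t0.
rewrite ln_div ?posrE ?divr_gt0// => h.
have : 0 <= Z * (S / Z * (ln (S / Z) - ln t) - S / Z + t).
  by apply: mulr_ge0 => //; exact: ltW.
have -> : Z * (S / Z * (ln (S / Z) - ln t) - S / Z + t) =
  S * (ln (S / Z) - ln t) - S + Z * t by field; rewrite gt_eqF.
lra.
Qed.

Lemma wentropy_ref (T : Type) (r : seq T) (W f : T -> R) :
  0 < \sum_(x <- r) W x -> 0 < \sum_(x <- r) W x * f x ->
  (forall x, 0 < f x) ->
  let t := (\sum_(x <- r) W x * f x) / \sum_(x <- r) W x in
  wentropy r W f = \sum_(x <- r) W x * (f x * ln (f x / t) - f x + t).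
Proof.
move=> Z0 S0 f0 t.
have t0 : 0 < t by exact: divr_gt0.
transitivity (\sum_(x <- r) W x * (f x * ln (f x))
   - (ln t + 1) * (\sum_(x <- r) W x * f x) + t * \sum_(x <- r) W x).
  rewrite /wentropy -/t.
  have -> : t * \sum_(x <- r) W x = \sum_(x <- r) W x * f x.
    by rewrite /t divfK// gt_eqF.
  ring.
rewrite !big_distrr/= -sumrB -big_split/=; apply: eq_bigr => x _.
rewrite ln_div ?posrE//; ring.
Qed.

Lemma sum_gt0_seq (T : eqType) (r : seq T) (W : T -> R) :
  r != [::] -> (forall x, x \in r -> 0 < W x) -> 0 < \sum_(x <- r) W x.
Proof.
case: r => // a r _ W0; rewrite big_cons ltr_pwDl ?W0 ?mem_head//.
by rewrite big_seq; apply: sumr_ge0 => x xr; rewrite ltW ?W0// inE xr orbT.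
Qed.

(** The Holley-Stroock perturbation argument: compare the variational forms at
    the mean under [W']. *)
Lemma wentropy_perturb (T : eqType) (r : seq T) (W W' f : T -> R) (A : R) :
  (forall x, x \in r -> 0 < W x <= A * W' x) -> (forall x, x \in r -> 0 < W' x) ->
  (forall x, 0 < f x) -> wentropy r W f <= A * wentropy r W' f.
Proof.
move=> WW' W'0 f0; have [->|r0] := eqVneq r [::].
  by rewrite /wentropy !big_nil !mul0r subrr mulr0.
have pos V : (forall x, x \in r -> 0 < V x) ->
  0 < \sum_(x <- r) V x /\ 0 < \sum_(x <- r) V x * f x.
  by move=> V0; split; apply: sum_gt0_seq => // x xr; rewrite ?mulr_gt0 ?V0.
have [Z'0 S'0] := pos _ W'0.
have [|Z0 S0] := pos W; first by move=> x /WW' /andP[].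
rewrite (wentropy_ref Z'0 S'0)//; set t := _ / _.
have t0 : 0 < t by exact: divr_gt0.
apply: (le_trans (wentropy_le_ref Z0 S0 t0 f0)).
rewrite big_distrr/= big_seq [leRHS]big_seq; apply: ler_sum => x /WW' /andP[_ h].
by rewrite mulrA ler_wpM2r// xlnx_ge.
Qed.

(** The reverse triangle inequality between [(p, a)] and [(q, b)]. *)
Lemma sqrt_add_dist (p q a b : R) :
  (Num.sqrt (p ^+ 2 + a ^+ 2) - Num.sqrt (q ^+ 2 + b ^+ 2)) ^+ 2 <=
  (p - q) ^+ 2 + (a - b) ^+ 2.
Proof.
have ge u v : 0 <= u ^+ 2 + v ^+ 2 :> R by rewrite addr_ge0 ?sqr_ge0.
have e1 := sqr_sqrtr (ge p a); have e2 := sqr_sqrtr (ge q b).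
have : p * q + a * b <= Num.sqrt (p ^+ 2 + a ^+ 2) * Num.sqrt (q ^+ 2 + b ^+ 2).
  apply: le_trans (ler_norm _) _.
  rewrite -ler_sqr ?nnegrE ?mulr_ge0 ?sqrtr_ge0// exprMn e1 e2 real_normK ?num_real//.
  rewrite -subr_ge0; apply: le_trans (sqr_ge0 (p * b - q * a)) _.
  by rewrite le_eqVlt; apply/orP; left; apply/eqP; ring.
rewrite sqrrB e1 e2 !sqrrB => h; lra.
Qed.

(** Joint convexity and homogeneity of [(x, y) -> (sqrt x - sqrt y) ^+ 2]; it
    transports a bound on differences through a coupling. *)
Lemma sqrt_mean_dist (T : Type) (r : seq T) (W A B : T -> R) :
  (forall x, 0 <= W x) -> (forall x, 0 <= A x) -> (forall x, 0 <= B x) ->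
  (Num.sqrt (\sum_(x <- r) W x * A x) - Num.sqrt (\sum_(x <- r) W x * B x)) ^+ 2
  <= \sum_(x <- r) W x * (Num.sqrt (A x) - Num.sqrt (B x)) ^+ 2.
Proof.
move=> W0 A0 B0.
elim: r => [|x r IH]; first by rewrite !big_nil subrr expr0n.
rewrite !big_cons.
have S0 (C : T -> R) : (forall x, 0 <= C x) -> 0 <= \sum_(x <- r) W x * C x.
  by move=> C0; apply: sumr_ge0 => y _; exact: mulr_ge0.
move: IH; set SA := \sum_(x <- r) W x * A x; set SB := \sum_(x <- r) W x * B x.
set SC := \sum_(x <- r) _ => IH.
apply: (le_trans _ (lerD (lexx _) IH)).
have SA0 : 0 <= SA by exact: S0.
have SB0 : 0 <= SB by exact: S0.
have -> : W x * A x = (Num.sqrt (W x) * Num.sqrt (A x)) ^+ 2.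
  by rewrite exprMn !sqr_sqrtr.
have -> : W x * B x = (Num.sqrt (W x) * Num.sqrt (B x)) ^+ 2.
  by rewrite exprMn !sqr_sqrtr.
have -> : W x * (Num.sqrt (A x) - Num.sqrt (B x)) ^+ 2 =
  (Num.sqrt (W x) * Num.sqrt (A x) - Num.sqrt (W x) * Num.sqrt (B x)) ^+ 2.
  by rewrite -[in LHS](sqr_sqrtr (W0 x)); ring.
rewrite -{1}(sqr_sqrtr SA0) -{1}(sqr_sqrtr SB0).
exact: sqrt_add_dist.
Qed.

End Means.

(** * Birth and death chains: integration by parts and its consequences *)

(** The law [m] of the occupation number of one of two sites sharing [N]
    particles, with the rates [B] and [D] at which that site gains and loses a
    particle.  [D] only increases and [B] only decreases with the occupation,
    and neither by less than [del]. *)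
Record birth_death (R : realType) (del a : R) (N : nat) (m B D : nat -> R) : Prop :=
  BirthDeath_ {
    bd_m : forall k, (k <= N)%N -> 0 < m k;
    bd_m1 : \sum_(0 <= k < N.+1) m k = 1;
    bd_rev : forall k, (k < N)%N -> m k * B k = m k.+1 * D k.+1;
    bd_D0 : D 0%N = 0;
    bd_BN : B N = 0;
    bd_Dinc : forall k, (k < N)%N -> del <= D k.+1 - D k <= a;
    bd_Binc : forall k, (k < N)%N -> del <= B k - B k.+1 <= a }.

(** Exchange of the two sites. *)
Lemma birth_death_rev (R : realType) (del a : R) (N : nat) (m B D : nat -> R) :
  birth_death del a N m B D ->
  birth_death del a N (fun k => m (N - k)%N) (fun k => D (N - k)%N)
    (fun k => B (N - k)%N).
Proof.
move=> H; split.
- by move=> k kN; apply: (bd_m H); rewrite leq_subr.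
- rewrite -[RHS](bd_m1 H) big_nat_rev/= big_nat [RHS]big_nat.
  by apply: eq_bigr => k /andP[_ kN]; congr m; lia.
- move=> k kN; rewrite (_ : (N - k)%N = (N - k.+1).+1); last lia.
  by rewrite (bd_rev H)//; lia.
- by rewrite subn0 (bd_BN H).
- by rewrite subnn (bd_D0 H).
- move=> k kN; rewrite (_ : (N - k)%N = (N - k.+1).+1); last lia.
  by apply: (bd_Binc H); lia.
- move=> k kN; rewrite (_ : (N - k)%N = (N - k.+1).+1); last lia.
  by apply: (bd_Dinc H); lia.
Qed.

Definition chain_mean (R : realType) (N : nat) (m g : nat -> R) : R :=
  \sum_(0 <= k < N.+1) m k * g k.

Definition chain_dirichlet (R : realType) (N : nat) (m B h : nat -> R) : R :=
  \sum_(0 <= k < N) m k * B k * (h k.+1 - h k) ^+ 2.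

(** Positive beyond the mode of the chain, negative before it. *)
Definition drift (R : realType) (B D : nat -> R) (k : nat) : R := D k - B k.

Section BirthDeath.
Context (R : realType) (del a : R) (N : nat) (m B D : nat -> R).
Context (del0 : 0 < del) (N0 : (0 < N)%N) (H : birth_death del a N m B D).

Local Notation E := (chain_mean N m).
Local Notation dir := (chain_dirichlet N m B).
Local Notation phi := (drift B D).

Lemma ler_sum_range (p q : nat) (F G : nat -> R) :
  (forall k, (p <= k < q)%N -> F k <= G k) ->
  \sum_(p <= k < q) F k <= \sum_(p <= k < q) G k.
Proof. by move=> FG; rewrite big_nat [leRHS]big_nat; exact: ler_sum. Qed.

Lemma sumr_ge0_range (p q : nat) (F : nat -> R) :
  (forall k, (p <= k < q)%N -> 0 <= F k) -> 0 <= \sum_(p <= k < q) F k.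
Proof. by move=> F0; rewrite big_nat; exact: sumr_ge0. Qed.

Lemma bd_ale : del <= a.
Proof. by have := bd_Dinc H N0; lra. Qed.

Lemma bd_a0 : 0 < a.
Proof. exact: lt_le_trans del0 bd_ale. Qed.

Lemma bd_Dle k : (k <= N)%N -> del * k%:R <= D k <= a * k%:R.
Proof.
elim: k => [_|k IH kN]; first by rewrite (bd_D0 H) !mulr0 lexx.
have := IH (ltnW kN); have := bd_Dinc H kN; rewrite -natr1 !mulrDr; lra.
Qed.

Lemma bd_Ble k : (k <= N)%N ->
  del * (N%:R - k%:R) <= B k <= a * (N%:R - k%:R).
Proof.
move=> kN; rewrite -natrB//.
suff S j : (j <= N)%N -> del * j%:R <= B (N - j)%N <= a * j%:R.
  by have := S (N - k)%N; rewrite subKn//; apply; rewrite leq_subr.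
elim: j => [_|j IH jN]; first by rewrite subn0 (bd_BN H) !mulr0 lexx.
have jN' : (N - j.+1 < N)%N by lia.
have := bd_Binc H jN'; rewrite (_ : (N - j.+1).+1 = N - j)%N; last lia.
by have := IH (ltnW jN); rewrite -natr1 !mulrDr; lra.
Qed.

Lemma bd_Drange k : (k <= N)%N -> 0 <= D k <= a * N%:R.
Proof.
move=> kN; have /andP[h1 h2] := bd_Dle kN; apply/andP; split.
  by apply: le_trans h1; rewrite mulr_ge0// ltW.
by apply: le_trans h2 _; rewrite ler_wpM2l ?ler_nat// ltW// bd_a0.
Qed.

Lemma bd_Brange k : (k <= N)%N -> 0 <= B k <= a * N%:R.
Proof.
move=> kN; have /andP[h1 h2] := bd_Ble kN; apply/andP; split.
  by apply: le_trans h1; rewrite mulr_ge0 ?subr_ge0 ?ler_nat// ltW.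
by apply: le_trans h2 _; rewrite ler_wpM2l ?gerBl ?ler0n// ltW// bd_a0.
Qed.

Lemma bd_BD k : (k <= N)%N -> del * N%:R <= B k + D k.
Proof.
move=> kN; have /andP[+ _] := bd_Dle kN; have /andP[+ _] := bd_Ble kN.
rewrite mulrBr; lra.
Qed.

Lemma phi_inc k : (k < N)%N -> 2 * del <= phi k.+1 - phi k <= 2 * a.
Proof.
by move=> kN; have := bd_Dinc H kN; have := bd_Binc H kN; rewrite /drift; lra.
Qed.

Lemma phi_mono i j : (i <= j <= N)%N -> 2 * del * (j%:R - i%:R) <= phi j - phi i.
Proof.
move=> /andP[ij]; elim: j ij => [|j IH] ij jN.
  by rewrite (_ : i = 0%N) ?subrr ?mulr0//; lia.
move: ij; rewrite leq_eqVlt => /predU1P[->|ij]; first by rewrite !subrr mulr0.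
have := IH ij (ltnW jN); have := phi_inc jN; rewrite -natr1; lra.
Qed.

(** Summation by parts: reversibility makes [phi] the discrete analogue of
    minus the logarithmic derivative of [m]. *)
Lemma stein (g : nat -> R) :
  E (fun k => phi k * g k) = \sum_(0 <= k < N) m k * B k * (g k.+1 - g k).
Proof.
transitivity (\sum_(0 <= k < N.+1) m k * D k * g k
              - \sum_(0 <= k < N.+1) m k * B k * g k).
  by rewrite -sumrB; apply: eq_bigr => k _; rewrite /drift; ring.
rewrite big_nat_recl// (bd_D0 H) mulr0 mul0r add0r.
rewrite [X in _ - X]big_nat_recr//= (bd_BN H) mulr0 mul0r addr0 -sumrB.
apply: eq_big_nat => k /andP[_ kN].
by rewrite -(bd_rev H)//; ring.
Qed.

Lemma edge_l (X : nat -> R) : (forall k, 0 <= X k) ->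
  \sum_(0 <= k < N) m k * B k * X k <= a * N%:R * E X.
Proof.
move=> X0.
have h : \sum_(0 <= k < N.+1) m k * B k * X k <= a * N%:R * E X.
  rewrite /chain_mean big_distrr/=; apply: ler_sum_range => k kN.
  have /andP[_ bB] := bd_Brange kN.
  rewrite -mulrA [leRHS]mulrCA ler_wpM2l ?(ltW (bd_m H _))//.
  by rewrite ler_wpM2r.
by move: h; rewrite big_nat_recr//= (bd_BN H) mulr0 mul0r addr0.
Qed.

Lemma edge_r (X : nat -> R) : (forall k, 0 <= X k) ->
  \sum_(0 <= k < N) m k * B k * X k.+1 <= a * N%:R * E X.
Proof.
move=> X0.
have h : \sum_(0 <= k < N.+1) m k * D k * X k <= a * N%:R * E X.
  rewrite /chain_mean big_distrr/=; apply: ler_sum_range => k kN.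
  have /andP[_ bB] := bd_Drange kN.
  rewrite -mulrA [leRHS]mulrCA ler_wpM2l ?(ltW (bd_m H _))//.
  by rewrite ler_wpM2r.
apply: le_trans h; rewrite [leRHS]big_nat_recl// (bd_D0 H) mulr0 mul0r add0r.
by apply: ler_sum_range => k /andP[_ kN]; rewrite (bd_rev H).
Qed.

(** With [G] the primitive of the squared increments of [h], Cauchy-Schwarz gives
    [2 del (h j - h i)^2 <= (phi j - phi i) (G j - G i)].  Averaging over
    independent [i] and [j] turns the right-hand side into a covariance, and
    [E (phi G)] is the Dirichlet form of [h] by [stein]. *)
Lemma poincare (h : nat -> R) :
  2 * del * (E (fun k => h k ^+ 2) - E h ^+ 2) <= dir h.
Proof.
have d0 : 0 <= 2 * del by rewrite mulr_ge0// ltW.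
pose G k := \sum_(0 <= l < k) (h l.+1 - h l) ^+ 2.
have step i j : (i <= j <= N)%N ->
    2 * del * (h j - h i) ^+ 2 <= (phi j - phi i) * (G j - G i)
    /\ 0 <= G j - G i.
  move=> /andP[ij]; elim: j ij => [|j IH] ij jN.
    by rewrite (_ : i = 0%N) ?subrr ?expr0n ?mulr0 ?lexx//; lia.
  move: ij; rewrite leq_eqVlt => /predU1P[->|ij].
    by rewrite !subrr expr0n !mulr0 lexx.
  rewrite ltnS in ij; have [IH1 IH2] := IH ij (ltnW jN).
  have p1 := phi_mono (introT andP (conj ij (ltnW jN))).
  have /andP[p2 _] := phi_inc jN.
  have -> : G j.+1 = G j + (h j.+1 - h j) ^+ 2 by rewrite /G big_nat_recr.
  have p3 : 0 <= phi j - phi i.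
    by apply: le_trans p1; rewrite (mulr_ge0 d0)// subr_ge0 ler_nat.

  set y := h j.+1 - h j; have -> : h j.+1 - h i = (h j - h i) + y by rewrite /y; ring.
  have -> : phi j.+1 - phi i = (phi j - phi i) + (phi j.+1 - phi j) by ring.
  have -> : G j + y ^+ 2 - G i = (G j - G i) + y ^+ 2 by ring.
  move: (phi j - phi i) (phi j.+1 - phi j) (G j - G i) (h j - h i) p3 p2 IH1 IH2
    => P p q x P0 p2 IH1 q0.
  have y0 := sqr_ge0 y; split; last by rewrite addr_ge0.
  have k1 : 2 * del * y ^+ 2 <= p * y ^+ 2 by rewrite ler_wpM2r.
  have k2 : 2 * del * q <= p * q by rewrite ler_wpM2r.
  (* the cross term, by the inequality of arithmetic and geometric means *)
  have k3 : 0 <= 2 * del * q + P * y ^+ 2 - 2 * (2 * del) * x * y.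
    have P'0 : 0 <= 2 * del * q + P * y ^+ 2.
      by rewrite addr_ge0 ?(mulr_ge0 d0)// mulr_ge0.
    rewrite subr_ge0; apply: le_trans (ler_norm _) _.
    rewrite -ler_sqr ?nnegrE// real_normK ?num_real//.
    have : 0 <= (2 * del) * y ^+ 2 * (P * q - 2 * del * x ^+ 2).
      by rewrite mulr_ge0 ?subr_ge0// (mulr_ge0 d0).
    have := sqr_ge0 (2 * del * q - P * y ^+ 2).
    lra.
  lra.
have pair i j : (i <= N)%N -> (j <= N)%N ->
    2 * del * ((h i - h j) * (h i - h j)) <= (phi i - phi j) * (G i - G j).
  move=> iN jN; have [ij|/ltnW ij] := leqP i j.
    have [+ _] := step i j (introT andP (conj ij jN)).
    by rewrite expr2; lra.
  by have [+ _] := step j i (introT andP (conj ij iN)).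
have c1 := cov_pairs h h (bd_m1 H); have c2 := cov_pairs phi G (bd_m1 H).
have phiG : \sum_(0 <= k < N.+1) m k * (phi k * G k) = dir h.
  have := stein G; rewrite /chain_mean => ->.
  by apply: eq_bigr => k _; rewrite /G big_nat_recr//=; ring.
have phi0 : \sum_(0 <= k < N.+1) m k * phi k = 0.
  transitivity (E (fun k => phi k * 1)).
    by apply: eq_bigr => k _; rewrite mulr1.
  by rewrite stein big1// => k _; rewrite subrr mulr0.
rewrite phiG phi0 mul0r subr0 in c2.
have : 2 * del * \sum_(0 <= i < N.+1) \sum_(0 <= j < N.+1)
    m i * m j * ((h i - h j) * (h i - h j)) <= 2 * dir h.
  rewrite -c2 big_distrr/=; apply: ler_sum_range => i iN.
  rewrite big_distrr/=; apply: ler_sum_range => j jN.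
  rewrite mulrCA ler_wpM2l ?mulr_ge0 ?(ltW (bd_m H _))//.
  exact: pair.
rewrite c1 => c3.
have -> : E (fun k => h k ^+ 2) = \sum_(0 <= i < N.+1) m i * (h i * h i).
  by apply: eq_bigr => k _; rewrite expr2.
rewrite expr2; move: c3; rewrite -/(E h); lra.
Qed.

(** Integration by parts of [phi * (phi h^2)]: the increments of [phi] contribute
    [E h^2], and those of [h] are separated by Young's inequality, leaving a
    fraction of the left-hand side that can be absorbed. *)
Lemma phi2_bound (h : nat -> R) :
  E (fun k => phi k ^+ 2 * h k ^+ 2) <=
  8 * a ^+ 2 * N%:R * E (fun k => h k ^+ 2) + 6 * a * N%:R * dir h.
Proof.
have a0 := bd_a0; have N1 : 1 <= N%:R :> R by rewrite ler1n.
have aN : 0 < a * N%:R by rewrite mulr_gt0//; lra.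
pose X k := phi k ^+ 2 * h k ^+ 2; pose Y k := h k ^+ 2.
have X0 k : 0 <= X k by rewrite mulr_ge0 ?sqr_ge0.
have Y0 k : 0 <= Y k by rewrite sqr_ge0.
have st : E X = \sum_(0 <= k < N) m k * B k *
    (phi k.+1 * h k.+1 ^+ 2 - phi k * h k ^+ 2).
  by rewrite -stein; apply: eq_bigr => k _; rewrite /X; ring.
have : E X <= \sum_(0 <= k < N) (2 * a * (m k * B k * Y k.+1)
   + 3 * a * N%:R * (m k * B k * (h k.+1 - h k) ^+ 2)
   + (6 * a * N%:R)^-1 * (m k * B k * X k)
   + (3 * a * N%:R)^-1 * (m k * B k * X k.+1)
   + 4 * a / (3 * N%:R) * (m k * B k * Y k.+1)).
  rewrite st; apply: ler_sum_range => k /andP[_ kN].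
  have w0 : 0 <= m k * B k.
    by rewrite mulr_ge0 ?(ltW (bd_m H _)) ?(ltnW kN)//; have /andP[] := bd_Brange (ltnW kN).
  set w := m k * B k in w0 *.
  suff : phi k.+1 * h k.+1 ^+ 2 - phi k * h k ^+ 2 <= 2 * a * Y k.+1
   + 3 * a * N%:R * (h k.+1 - h k) ^+ 2
   + (6 * a * N%:R)^-1 * X k + (3 * a * N%:R)^-1 * X k.+1
   + 4 * a / (3 * N%:R) * Y k.+1.
    move=> /(ler_wpM2l w0) /le_trans; apply.
    by rewrite le_eqVlt; apply/orP; left; apply/eqP; ring.
  have := phi_inc kN; rewrite /X /Y.
  move: (phi k) (phi k.+1) (h k) (h k.+1) => p p' x x' pp.
  rewrite (_ : (6 * a * N%:R)^-1 = (3 * a * N%:R)^-1 / 2); last first.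
    by field; rewrite !gt_eqF//; lra.
  rewrite (_ : 4 * a / (3 * N%:R) = 4 * a ^+ 2 * (3 * a * N%:R)^-1); last first.
    by field; rewrite !gt_eqF//; lra.
  (* Young's parameter: with [3 a N] the two terms in [X] above add up to at
     most half of [E X] *)
  have T0 : 0 < 3 * a * N%:R by lra.
  have : (3 * a * N%:R) * (3 * a * N%:R)^-1 = 1 by rewrite mulfV// gt_eqF.
  have : 0 <= (3 * a * N%:R)^-1 by rewrite invr_ge0 ltW.
  move: (3 * a * N%:R) (3 * a * N%:R)^-1 T0 => T i T0 i0 Ti.
  have s1 : (p' - p) * x' ^+ 2 <= 2 * a * x' ^+ 2.
    by rewrite ler_wpM2r ?sqr_ge0//; lra.
  have s2 : p * (x' - x) * (x' + x) <=
      T * (x' - x) ^+ 2 + i / 4 * (p ^+ 2 * (x' + x) ^+ 2).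
    have := mulr_ge0 (ltW T0) (sqr_ge0 (x' - x - p * (x' + x) * i / 2)).
    have -> : T * (x' - x - p * (x' + x) * i / 2) ^+ 2 = T * (x' - x) ^+ 2 -
      (T * i) * (p * (x' - x) * (x' + x)) +
      (T * i) * (i / 4 * (p ^+ 2 * (x' + x) ^+ 2)) by field.
    by rewrite Ti; lra.
  have s3 : p ^+ 2 <= 2 * p' ^+ 2 + 8 * a ^+ 2.
    have f1 : 0 <= 2 * a - (p' - p) by lra.
    have f2 : 0 <= 2 * a + (p' - p) by have := del0; lra.
    have := mulr_ge0 f1 f2.
    have := sqr_ge0 (p - 2 * p'); lra.
  have s4 : i * (p ^+ 2 * x' ^+ 2) <= i * ((2 * p' ^+ 2 + 8 * a ^+ 2) * x' ^+ 2).
    by rewrite ler_wpM2l// ler_wpM2r ?sqr_ge0.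
  have s5 : i * (p ^+ 2 * (x' + x) ^+ 2) <=
      i * (p ^+ 2 * (2 * x ^+ 2 + 2 * x' ^+ 2)).
    rewrite ler_wpM2l// ler_wpM2l ?sqr_ge0//.
    have := sqr_ge0 (x' - x); lra.
  lra.
rewrite !big_split/= -!big_distrr/=.
have e1 := edge_r Y0; have e2 := edge_l X0; have e3 := edge_r X0.
rewrite -/(dir h).
have i0 : 0 < (a * N%:R)^-1 by rewrite invr_gt0.
have aNn : a * N%:R != 0 by rewrite gt_eqF.
rewrite (_ : (6 * a * N%:R)^-1 = (a * N%:R)^-1 / 6); last first.
  by field; rewrite !gt_eqF//; lra.
rewrite (_ : (3 * a * N%:R)^-1 = (a * N%:R)^-1 / 3); last first.
  by field; rewrite !gt_eqF//; lra.
rewrite (_ : 4 * a / (3 * N%:R) = 4 / 3 * a ^+ 2 * (a * N%:R)^-1); last first.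
  by field; rewrite !gt_eqF//; lra.
have {e2} e2 : (a * N%:R)^-1 * (\sum_(0 <= i < N) m i * B i * X i) <= E X.
  by rewrite -[leRHS](mulKf aNn) ler_pM2l.
have {e3} e3 : (a * N%:R)^-1 * (\sum_(0 <= i < N) m i * B i * X i.+1) <= E X.
  by rewrite -[leRHS](mulKf aNn) ler_pM2l.
have e4 : a ^+ 2 * ((a * N%:R)^-1 * (\sum_(0 <= i < N) m i * B i * Y i.+1))
    <= a ^+ 2 * E Y.
  rewrite ler_wpM2l ?sqr_ge0//.
  by rewrite -[leRHS](mulKf aNn) ler_pM2l.
have e5 : a * (\sum_(0 <= i < N) m i * B i * Y i.+1) <= a * (a * N%:R * E Y).
  by rewrite ler_pM2l.
have EY0 : 0 <= E Y.
  by apply: sumr_ge0_range => k kN; rewrite mulr_ge0// ltW// (bd_m H).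
have e6 : a ^+ 2 * E Y <= a ^+ 2 * E Y * N%:R by rewrite ler_peMr// mulr_ge0// sqr_ge0.
have e7 : 0 <= a ^+ 2 * E Y by rewrite mulr_ge0// sqr_ge0.
rewrite -/(E Y) -/(E X); lra.
Qed.

(** Integration by parts on [0, k]: the boundary term is the flux of [h^2] out of
    that interval. *)
Lemma flux_l (h : nat -> R) k : (k <= N)%N ->
  m k * B k * h k ^+ 2 =
  \sum_(0 <= j < k) m j * B j * (h j.+1 ^+ 2 - h j ^+ 2)
  - \sum_(0 <= j < k.+1) m j * (phi j * h j ^+ 2).
Proof.
elim: k => [_|k IH kN].
  by rewrite big_nil big_nat1 /drift (bd_D0 H); ring.
rewrite big_nat_recr//= [X in _ - X]big_nat_recr//=.
have := IH (ltnW kN); have e := bd_rev H kN.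
have -> : m k.+1 * (phi k.+1 * h k.+1 ^+ 2) =
  m k * B k * h k.+1 ^+ 2 - m k.+1 * B k.+1 * h k.+1 ^+ 2.
  by rewrite e /drift; ring.
lra.
Qed.

(** Each boundary flux [m B h^2] or [m D h^2] is at most the total variation of
    [h^2] plus [E (|phi| h^2)], both at most of order [sqrt N (1 + dir h)].  One of the
    two rates is of order [N] at every point, including those near [0] and [N],
    which gives the bound on [m h^2]. *)
Lemma density_bound (h : nat -> R) k : (k <= N)%N ->
  E (fun k => h k ^+ 2) = 1 ->
  del * Num.sqrt N%:R * (m k * h k ^+ 2) <=
  2 * (4 * a ^+ 2 + 4 * a + 2) * (1 + dir h).
Proof.
move=> kN Eh; have a0 := bd_a0.
set s := Num.sqrt N%:R.
have s0 : 0 < s by rewrite sqrtr_gt0 ltr0n.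
have s2 : N%:R = s ^+ 2 by rewrite sqr_sqrtr.
have w0 j : (j <= N)%N -> 0 <= m j * B j.
  by move=> jN; rewrite mulr_ge0 ?(ltW (bd_m H jN))//; have /andP[] := bd_Brange jN.
pose T1 := \sum_(0 <= j < N) m j * B j * `|h j.+1 ^+ 2 - h j ^+ 2|.
pose T2 := \sum_(0 <= j < N.+1) m j * (`|phi j| * h j ^+ 2).
have P1 i : (i <= N)%N ->
    \sum_(0 <= j < i) m j * B j * (h j.+1 ^+ 2 - h j ^+ 2) <= T1.
  move=> iN; rewrite /T1 (big_cat_nat (leq0n i) iN)//= -[leLHS]addr0 lerD//.
    apply: ler_sum_range => j /andP[_ ji].
    by rewrite ler_wpM2l ?w0 ?ler_norm//; lia.
  by apply: sumr_ge0_range => j /andP[_ jN]; rewrite mulr_ge0// w0// ltnW.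
have P2 i : (i <= N.+1)%N -> - \sum_(0 <= j < i) m j * (phi j * h j ^+ 2) <= T2.
  move=> iN; rewrite /T2 (big_cat_nat (leq0n i) iN)//= -[leLHS]addr0 lerD//.
    rewrite -sumrN; apply: ler_sum_range => j /andP[_ ji].
    rewrite -mulrN ler_wpM2l ?(ltW (bd_m H _))//; first by lia.
    by rewrite -mulNr ler_wpM2r ?sqr_ge0// -normrN ler_norm.
  apply: sumr_ge0_range => j /andP[_ jN].
  by rewrite mulr_ge0 ?(ltW (bd_m H _))// mulr_ge0// sqr_ge0.
have hB : m k * B k * h k ^+ 2 <= T1 + T2.
  by rewrite flux_l// lerD ?P1 ?P2.
have hD : m k * D k * h k ^+ 2 <= T1 + T2.
  have -> : m k * D k * h k ^+ 2 = m k * B k * h k ^+ 2 + m k * (phi k * h k ^+ 2).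
    by rewrite /drift; ring.
  rewrite flux_l// [X in _ - X]big_nat_recr//= opprD addrA subrK.
  by rewrite lerD ?P1 ?P2// ltnW.
have hT1 : T1 <= s * dir h + a * s.
  pose X j := h j ^+ 2.
  have X0 j : 0 <= X j by exact: sqr_ge0.
  have e1 := edge_l X0; have e2 := edge_r X0.
  have {e1 e2} e : (2 * s)^-1 * (\sum_(0 <= j < N) m j * B j * X j)
    + (2 * s)^-1 * (\sum_(0 <= j < N) m j * B j * X j.+1) <= a * s.
    have -> : a * s = (2 * s)^-1 * (a * N%:R * E X + a * N%:R * E X).
      by rewrite Eh s2; field; rewrite gt_eqF.
    rewrite -mulrDr ler_pM2l; first exact: lerD.
    by rewrite invr_gt0 mulr_gt0.
  apply: (@le_trans _ _ (\sum_(0 <= j < N) (s * (m j * B j * (h j.+1 - h j) ^+ 2) +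
     ((2 * s)^-1 * (m j * B j * X j) + (2 * s)^-1 * (m j * B j * X j.+1))))).
    apply: ler_sum_range => j /andP[_ jN].
    have -> : s * (m j * B j * (h j.+1 - h j) ^+ 2) +
     ((2 * s)^-1 * (m j * B j * X j) + (2 * s)^-1 * (m j * B j * X j.+1)) =
      m j * B j * (s * (h j.+1 - h j) ^+ 2 + (2 * s)^-1 * (X j + X j.+1)) by ring.
    rewrite ler_wpM2l ?w0 1?ltnW// /X.
    have -> : (2 * s)^-1 = s^-1 / 2 by field; rewrite gt_eqF.
    have i0 : 0 < s^-1 by rewrite invr_gt0.
    have si : s * s^-1 = 1 by rewrite mulfV// gt_eqF.
    move: (h j) (h j.+1) (s^-1) i0 si => x y i i0 si.
    have b u v : u * v <= s * u ^+ 2 + i / 4 * v ^+ 2.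
      have := mulr_ge0 (ltW s0) (sqr_ge0 (u - v * i / 2)).
      have -> : s * (u - v * i / 2) ^+ 2 = s * u ^+ 2 -
        (s * i) * (u * v) + (s * i) * (i / 4 * v ^+ 2) by field.
      by rewrite si; lra.
    have q : i / 4 * (y + x) ^+ 2 <= i / 2 * (x ^+ 2 + y ^+ 2).
      have := mulr_ge0 (ltW i0) (sqr_ge0 (y - x)); lra.
    rewrite ler_norml; apply/andP; split.
      by have := b (x - y) (x + y); lra.
    by have := b (y - x) (x + y); lra.
  by rewrite !big_split/= -!big_distrr/= lerD.
have hT2 : T2 <= s * (4 * a ^+ 2 + 3 * a * dir h + 2^-1).
  have := phi2_bound h; rewrite Eh s2 => pb.
  apply: (@le_trans _ _ (\sum_(0 <= j < N.+1)
     ((2 * s)^-1 * (m j * (phi j ^+ 2 * h j ^+ 2)) + s / 2 * (m j * h j ^+ 2)))).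
    apply: ler_sum_range => j /andP[_ jN].
    have -> : (2 * s)^-1 * (m j * (phi j ^+ 2 * h j ^+ 2)) + s / 2 * (m j * h j ^+ 2)
      = m j * (((2 * s)^-1 * phi j ^+ 2 + s / 2) * h j ^+ 2) by ring.
    rewrite ler_wpM2l ?(ltW (bd_m H _))// ler_wpM2r ?sqr_ge0//.
    rewrite -(real_normK (num_real (phi j))).
    have -> : (2 * s)^-1 * `|phi j| ^+ 2 + s / 2 =
      `|phi j| + (2 * s)^-1 * (`|phi j| - s) ^+ 2 by field; rewrite gt_eqF.
    by rewrite lerDl mulr_ge0 ?sqr_ge0// invr_ge0 mulr_ge0// ltW.
  rewrite big_split/= -!big_distrr/= -/(E (fun k => h k ^+ 2)) Eh.
  have -> : s * (4 * a ^+ 2 + 3 * a * dir h + 2^-1) =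
    (2 * s)^-1 * (8 * a ^+ 2 * s ^+ 2 * 1 + 6 * a * s ^+ 2 * dir h) + s / 2 * 1.
    by field; rewrite gt_eqF.
  by rewrite lerD2r ler_pM2l// invr_gt0 mulr_gt0.
have dir0 : 0 <= dir h.
  apply: sumr_ge0_range => j /andP[_ jN].
  by rewrite mulr_ge0 ?w0 ?sqr_ge0// ltnW.
rewrite -(ler_pM2l s0).
have h1 : del * N%:R * (m k * h k ^+ 2) <= (B k + D k) * (m k * h k ^+ 2).
  rewrite ler_wpM2r ?bd_BD// mulr_ge0 ?sqr_ge0// ltW// (bd_m H)//.
rewrite s2 in h1.
have g1 : 0 <= a * (dir h) by rewrite mulr_ge0// ltW.
have g2 : 0 <= a ^+ 2 * (dir h) by rewrite mulr_ge0// sqr_ge0.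
have h2 : T1 + T2 <= s * ((4 * a ^+ 2 + 4 * a + 2) * (1 + dir h)).
  apply: (@le_trans _ _ (s * (dir h + a + (4 * a ^+ 2 + 3 * a * dir h + 2^-1)))).
    by move: hT1 hT2; lra.
  by rewrite ler_pM2l//; lra.
lra.
Qed.
End BirthDeath.

(** * Lower bounds on the mass of a birth and death chain *)

Section Mode.
Context (R : realType).

(** To the right of a point where the drift is bounded below, [m] decreases at
    most like a Gaussian of variance of order [N] as long as [N - k] is of
    order [N].  Closer to [N] the birth rate degenerates, but there the drift is
    itself of order [N], and it suffices that [m] loses at most a factor
    exponential in [N]. *)
Lemma tail_lower_bound (del a : R) : 0 < del -> exists K : R, 0 <= K /\
  forall N m B D i k, (0 < N)%N -> birth_death del a N m B D ->
  (i <= k <= N)%N -> - a <= drift B D i ->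
  ln (m i) - ln (m k) <= K * (1 + drift B D k ^+ 2 / N%:R).
Proof.
move=> del0; have [a0|a0] := leP a 0.
  exists 0; split=> // N m B D i k N0 H.
  by have := bd_a0 del0 N0 H; rewrite ltNge a0.
(* with this [eps], the drift is at least [del * N / 2] where
   [N - k <= eps * N] *)
pose eps := del / (2 * (del + a)).
have eps0 : 0 < eps by rewrite divr_gt0// mulr_gt0// addr_gt0.
pose K1 := (1 + a ^+ 2) / (del ^+ 2 * eps).
pose K2 := 16 * Num.sqrt (a / del) / del ^+ 2.
have K10 : 0 <= K1.
  apply: divr_ge0; first by rewrite addr_ge0 ?sqr_ge0.
  by apply: mulr_ge0; [exact: sqr_ge0|exact: ltW].
have K20 : 0 <= K2.
  by apply: divr_ge0; [apply: mulr_ge0; rewrite ?sqrtr_ge0|exact: sqr_ge0].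
exists (K1 + K2); split; first exact: addr_ge0.
move=> N m B D i k N0 H /andP[ik kN] phii.
set phi := drift B D in phii *.
have N1 : 0 < N%:R :> R by rewrite ltr0n.
have N11 : 1 <= N%:R :> R by rewrite ler1n.
have pm j : (i <= j <= N)%N -> - a <= phi j.
  move=> ijN; have := phi_mono del0 N0 H ijN; move/andP: ijN => [ij jN].
  have : 0 <= 2 * del * (j%:R - i%:R).
    by apply: mulr_ge0; rewrite ?subr_ge0 ?ler_nat// mulr_ge0// ltW.
  by rewrite -/phi; lra.
have stepE : ln (m i) - ln (m k) = \sum_(i <= j < k) (ln (m j) - ln (m j.+1)).
  have := telescope_sumr (fun j => ln (m j)) ik => /(congr1 -%R).
  by rewrite opprB -sumrN => <-; apply: eq_bigr => j _; rewrite opprB.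
have Bpos j : (j < N)%N -> 0 < B j.
  move=> jN; have /andP[h _] := bd_Ble del0 N0 H (ltnW jN); apply: lt_le_trans h.
  by rewrite mulr_gt0// subr_gt0 ltr_nat.
have Dpos j : (0 < j <= N)%N -> 0 < D j.
  move=> /andP[j0 jN]; have /andP[h _] := bd_Dle H jN; apply: lt_le_trans h.
  by rewrite mulr_gt0// ltr0n.
have stepD j : (j < k)%N -> ln (m j) - ln (m j.+1) = ln (D j.+1 / B j).
  move=> jk; have jN : (j < N)%N by exact: leq_trans jk kN.
  have m1 := bd_m H jN; have m0 := bd_m H (ltnW jN).
  have B0 := Bpos j jN; have D0 : 0 < D j.+1 by apply: Dpos.
  have := congr1 (@ln R) (bd_rev H jN).
  rewrite ln_div ?posrE// !lnM ?posrE//; lra.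
rewrite stepE.
have [kb|kb] := leP (eps * N%:R) (N%:R - k%:R).
  apply: (@le_trans _ _ (K1 * (1 + phi k ^+ 2 / N%:R))); last first.
    by rewrite ler_wpM2r ?lerDl// addr_ge0// divr_ge0 ?sqr_ge0 ?ltW.
  pose y := phi k + a.
  have y0 : 0 <= y by have := pm k; rewrite ik kN /y => /(_ erefl); lra.
  apply: (@le_trans _ _ (\sum_(i <= j < k) y / (del * eps * N%:R))).
    apply: ler_sum_range => j /andP[ij jk]; rewrite stepD//.
    have jN : (j < N)%N by exact: leq_trans jk kN.
    have B0 := Bpos _ jN; have D0 : 0 < D j.+1 by apply: Dpos.
    apply: le_trans (ln_leB1 (divr_gt0 D0 B0)) _.
    have -> : D j.+1 / B j - 1 = (D j.+1 - B j) / B j by field; rewrite gt_eqF.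
    have d0 : D j.+1 - B j <= y.
      have /andP[_ h1] := bd_Dinc H jN.
      have h2 := phi_mono del0 N0 H (_ : (j <= k <= N)%N).
      have {h2} h2 : 2 * del * (k%:R - j%:R) <= phi k - phi j.
        by apply: h2; rewrite kN ltnW.
      have h3 : 0 <= 2 * del * (k%:R - j%:R).
        by apply: mulr_ge0; rewrite ?subr_ge0 ?ler_nat ?(ltnW jk)// mulr_ge0// ltW.
      have h4 : phi j = D j - B j by [].
      by rewrite /y; lra.
    have e0 : 0 < del * eps * N%:R by rewrite mulr_gt0// mulr_gt0.
    apply: (@le_trans _ _ (y / B j)); first by rewrite ler_wpM2r// invr_ge0 ltW.
    rewrite ler_wpM2l// lef_pV2 ?posrE//.
    have /andP[h1 _] := bd_Ble del0 N0 H (ltnW jN); apply: le_trans h1.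
    rewrite -mulrA ler_pM2l//; apply: (le_trans kb).
    by rewrite lerD2l lerN2 ler_nat ltnW.
  rewrite sumr_const_nat.
  have h1 := phi_mono del0 N0 H (introT andP (conj ik kN)).
  have h2 : del * (k - i)%:R <= y / 2.
    by rewrite natrB//; move: h1; rewrite -/phi /y; lra.
  have e0 : 0 < del * eps * N%:R by rewrite mulr_gt0// mulr_gt0.
  have -> : K1 * (1 + phi k ^+ 2 / N%:R) =
     (1 + a ^+ 2) * (N%:R + phi k ^+ 2) / del / (del * eps * N%:R).
    by rewrite /K1; field; rewrite !gt_eqF.
  rewrite -[leLHS]mulr_natr mulrAC ler_pM2r ?invr_gt0// ler_pdivlMr//.
  have h3 : y * (k - i)%:R * del <= y * (y / 2).
    by rewrite -mulrA ler_wpM2l// mulrC.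
  apply: le_trans h3 _.
  have := sqr_ge0 (phi k - a); have := sqr_ge0 (a * phi k).
  have : a ^+ 2 <= a ^+ 2 * N%:R by rewrite ler_peMr ?sqr_ge0.
  by rewrite /y; lra.
apply: (@le_trans _ _ (K2 * (1 + phi k ^+ 2 / N%:R))); last first.
  by rewrite ler_wpM2r ?lerDr// addr_ge0// divr_ge0 ?sqr_ge0 ?ltW.
have phik : del * N%:R / 2 <= phi k.
  have /andP[h1 _] := bd_Dle H kN; have /andP[_ h2] := bd_Ble del0 N0 H kN.
  have : (del + a) * (N%:R - k%:R) <= (del + a) * (eps * N%:R).
    by rewrite ler_wpM2l ?addr_ge0 ?ltW.
  have -> : (del + a) * (eps * N%:R) = del * N%:R / 2.
    by rewrite /eps; field; rewrite gt_eqF// addr_gt0.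
  rewrite /phi /drift; lra.
pose q : R := Num.sqrt (a / del); have q0 : 0 <= q by exact: sqrtr_ge0.
pose s : R := Num.sqrt N%:R; have s0 : 0 < s by rewrite sqrtr_gt0.
have s2 : s ^+ 2 = N%:R by rewrite sqr_sqrtr// ltW.
(* near [N] the increments are at most [ln (a N / (del (N - j)))], hence at most
   a multiple of [sqrt (N / (N - j))], which is summed by telescoping [r] *)
pose r j := - Num.sqrt (N - j)%:R : R.
apply: (@le_trans _ _ (\sum_(i <= j < k) 4 * q * s * (r j.+1 - r j))).
  apply: ler_sum_range => j /andP[ij jk]; rewrite stepD//.
  have jN : (j < N)%N by exact: leq_trans jk kN.
  have B0 := Bpos _ jN; have D0 : 0 < D j.+1 by apply: Dpos.
  pose t : R := Num.sqrt (N - j)%:R.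
  have t0 : 0 < t by rewrite sqrtr_gt0 ltr0n subn_gt0.
  have t2 : t ^+ 2 = N%:R - j%:R by rewrite sqr_sqrtr ?ler0n// natrB// ltnW.
  have DB0 : 0 < D j.+1 / B j by rewrite divr_gt0.
  have l1 : D j.+1 / B j <= (q * s / t) ^+ 2.
    rewrite !exprMn exprVn s2 t2 sqr_sqrtr ?(divr_ge0 (ltW a0) (ltW del0))//.
    have n0 : 0 < N%:R - j%:R :> R by rewrite subr_gt0 ltr_nat.
    have -> : a / del * N%:R / (N%:R - j%:R) = a * N%:R / (del * (N%:R - j%:R)).
      by field; rewrite !gt_eqF.
    have /andP[_ h1] := bd_Drange del0 N0 H jN.
    have /andP[h2 _] := bd_Ble del0 N0 H (ltnW jN).
    rewrite ler_pdivrMr//; apply: le_trans h1 _.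
    rewrite -[leRHS]mulrA ler_peMr ?mulr_ge0 ?(ltW a0)//.
    by rewrite mulrC ler_pdivlMr ?mul1r// mulr_gt0.
  have qst : 0 < q * s / t by rewrite divr_gt0// mulr_gt0// sqrtr_gt0 divr_gt0.
  have l2 : ln (D j.+1 / B j) <= 2 * (q * s / t).
    apply: (@le_trans _ _ (ln ((q * s / t) ^+ 2))).
      by rewrite ler_ln ?posrE ?exprn_gt0.
    by rewrite lnXn// mulr2n; have := ln_leB1 qst; lra.
  apply: le_trans l2 _.
  rewrite /r.
  rewrite -/t; pose t' : R := Num.sqrt (N - j.+1)%:R; rewrite -/t'.
  have t'0 : 0 <= t' by exact: sqrtr_ge0.
  have t'2 : t' ^+ 2 = t ^+ 2 - 1.
    by rewrite sqr_sqrtr// t2 natrB// -natr1; lra.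
  have tt : t' <= t by rewrite ler_wsqrtr// ler_nat leq_sub2l.
  have -> : 2 * (q * s / t) = 4 * q * s * (2 * t)^-1 by field; rewrite gt_eqF.
  rewrite ler_wpM2l ?mulr_ge0 ?(ltW s0)//.
  rewrite -[(2 * t)^-1]mul1r ler_pdivrMr ?mulr_gt0//.
  have : 0 <= (t - t') * (t - t') by rewrite mulr_ge0 ?subr_ge0.
  lra.
rewrite -big_distrr/= telescope_sumr// /r.
have h : - Num.sqrt (N - k)%:R - - Num.sqrt (N - i)%:R <= s.
  have := sqrtr_ge0 ((N - k)%:R : R).
  have : Num.sqrt (N - i)%:R <= s by rewrite ler_wsqrtr// ler_nat leq_subr.
  lra.
apply: (@le_trans _ _ (4 * q * s * s)).
  by rewrite ler_wpM2l// !mulr_ge0// ltW.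
rewrite -mulrA -expr2 s2 /K2 -/q.
have p2 : (del * N%:R / 2) ^+ 2 <= phi k ^+ 2.
  by rewrite ler_sqr ?nnegrE// ?(le_trans _ phik)// divr_ge0// mulr_ge0 ?ltW.
have -> : 16 * q / del ^+ 2 * (1 + phi k ^+ 2 / N%:R) =
  16 * q * ((N%:R + phi k ^+ 2) / (del ^+ 2 * N%:R)).
  by field; rewrite !gt_eqF.
have -> : 4 * q * N%:R = 16 * q * (N%:R / 4) by field.
rewrite ler_wpM2l ?mulr_ge0//.
rewrite ler_pdivlMr ?mulr_gt0 ?exprn_gt0//; lra.
Qed.

End Mode.

Section LowerBound.
Context (R : realType).

Lemma exists_argmax (m : nat -> R) (n : nat) :
  exists2 i, (i <= n)%N & forall k, (k <= n)%N -> m k <= m i.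
Proof.
elim: n => [|n [i ile imax]].
  by exists 0%N => // k; rewrite leqn0 => /eqP ->.
have [h|h] := leP (m i) (m n.+1).
  exists n.+1 => // k; rewrite leq_eqVlt => /predU1P[->//|kn].
  exact: le_trans (imax k kn) h.
exists i; first exact: leqW.
move=> k; rewrite leq_eqVlt => /predU1P[->|kn]; first exact: ltW.
exact: imax.
Qed.

(** At the mode, detailed balance with each neighbour forces the two rates to
    agree up to one increment. *)
Lemma mode_drift (del a : R) N m B D i : 0 < del -> (0 < N)%N ->
  birth_death del a N m B D -> (i <= N)%N ->
  (forall k, (k <= N)%N -> m k <= m i) ->
  - a <= drift B D i <= a.
Proof.
move=> del0 N0 H iN imax; have a0 := bd_a0 del0 N0 H.
have /andP[D0 _] := bd_Drange del0 N0 H iN.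
have /andP[B0 _] := bd_Brange del0 N0 H iN.
rewrite /drift; apply/andP; split.
  move: iN; rewrite leq_eqVlt => /predU1P[iE|iN].
    by rewrite iE (bd_BN H) subr0 -iE; lra.
  have D1 : 0 <= D i.+1 by have /andP[] := bd_Drange del0 N0 H iN.
  have : B i <= D i.+1.
    rewrite -(ler_pM2l (bd_m H (ltnW iN))) (bd_rev H iN).
    by rewrite ler_wpM2r// imax.
  have := bd_Dinc H iN; lra.
case: i iN imax D0 B0 => [|i] iN imax D0 B0; first by rewrite (bd_D0 H); lra.
have B1 : 0 <= B i by have /andP[] := bd_Brange del0 N0 H (ltnW iN).
have : D i.+1 <= B i.
  rewrite -(ler_pM2l (bd_m H iN)) -(bd_rev H iN).
  by rewrite ler_wpM2r// imax// ltnW.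
have := bd_Binc H iN; lra.
Qed.

(** By Chebyshev, half of the mass lies where [|phi| <= s], with [s] of order
    [sqrt N]; as [phi] increases by at least [2 * del] at each step, there are
    at most [1 + s / del] such points, none heavier than the mode.  They are
    counted by telescoping [phi] truncated to a slightly larger interval. *)
Lemma mode_lower_bound (del a : R) N m B D i : 0 < del -> (0 < N)%N ->
  birth_death del a N m B D -> (i <= N)%N ->
  (forall k, (k <= N)%N -> m k <= m i) ->
  del <= m i * ((4 * del + 8 * a) * Num.sqrt N%:R).
Proof.
move=> del0 N0 H iN imax; have a0 := bd_a0 del0 N0 H.
pose phi := drift B D.
pose rN : R := Num.sqrt N%:R.
have N1 : 1 <= N%:R :> R by rewrite ler1n.
have r0 : 0 < rN by rewrite sqrtr_gt0 ltr0n.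
have r2 : rN ^+ 2 = N%:R by rewrite sqr_sqrtr.
have r1 : 1 <= rN by rewrite -sqrtr1 ler_wsqrtr.
pose s := 4 * a * rN.
have s0 : 0 < s by rewrite mulr_gt0// mulr_gt0.
pose clip x : R := Num.min (Num.max x (- s)) (s + 2 * del).
have clip_le x : clip x <= s + 2 * del by rewrite /clip ge_min lexx orbT.
have clip_ge x : - s <= clip x.
  by rewrite /clip le_min le_max lexx orbT/=; lra.
have clip_mono x y : x <= y -> clip x <= clip y.
  by move=> xy; rewrite /clip le_min2// le_max2.
have clip_in x : - s <= x <= s + 2 * del -> clip x = x.
  by move=> /andP[x1 x2]; rewrite /clip max_l// min_l.
have mi0 : 0 < m i by exact: (bd_m H).
have Q := phi2_bound del0 N0 H (fun=> 1).
have E1 : chain_mean N m (fun=> 1 ^+ 2) = 1.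
  rewrite /chain_mean -[RHS](bd_m1 H); apply: eq_bigr => k _.
  by rewrite expr1n mulr1.
have D0 : chain_dirichlet N m B (fun=> 1) = 0.
  by rewrite /chain_dirichlet big1// => k _; rewrite subrr expr0n mulr0.
rewrite E1 D0 mulr1 mulr0 addr0 in Q.
have tot : 1 <= m i * (1 + (2 * s + 2 * del) / (2 * del)) + 2^-1.
  rewrite -{1}(bd_m1 H) big_nat_recr//=.
  have -> : m i * (1 + (2 * s + 2 * del) / (2 * del)) + 2^-1 =
   (m i * ((2 * s + 2 * del) / (2 * del)) + 2^-1) + m i by ring.
  apply: lerD; last exact: imax.
  apply: (@le_trans _ _ (\sum_(0 <= k < N) (m i / (2 * del) *
     (clip (phi k.+1) - clip (phi k)) + (s ^+ 2)^-1 * (m k * phi k ^+ 2)))).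
    apply: ler_sum_range => k /andP[_ kN].
    have mk0 := bd_m H (ltnW kN).
    have /andP[p1 _] := phi_inc H kN; rewrite -!/(phi _) in p1.
    have c0 : 0 <= clip (phi k.+1) - clip (phi k).
      by rewrite subr_ge0 clip_mono//; lra.
    have q0 : 0 <= m i / (2 * del) * (clip (phi k.+1) - clip (phi k)).
      by rewrite mulr_ge0// divr_ge0// ltW// mulr_gt0.
    have q1 : 0 <= (s ^+ 2)^-1 * (m k * phi k ^+ 2).
      by rewrite mulr_ge0 ?invr_ge0 ?sqr_ge0// mulr_ge0 ?sqr_ge0// ltW.
    have [ps|ps] := leP `|phi k| s.
      have /andP[ps1 ps2] : - s <= phi k <= s by rewrite -ler_norml.
      have cd : 2 * del <= clip (phi k.+1) - clip (phi k).
        rewrite [clip (phi k)]clip_in; last by rewrite ps1/=; lra.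
        have : phi k + 2 * del <= clip (phi k.+1).
          by rewrite /clip le_min le_max; apply/andP; split; [apply/orP; left|]; lra.
        lra.
      rewrite -[leLHS]addr0 lerD//; apply: le_trans (imax k (ltnW kN)) _.
      have d0 : 0 < 2 * del by rewrite mulr_gt0.
      by rewrite mulrAC ler_pdivlMr// ler_pM2l.
    rewrite -[leLHS]add0r lerD// mulrC -mulrA ler_peMr ?(ltW mk0)//.
    rewrite ler_pdivlMr ?exprn_gt0// mul1r.
    rewrite -(real_normK (num_real (phi k))) ler_sqr ?nnegrE ?(ltW s0)//.
    exact: ltW.
  rewrite big_split/= -!big_distrr/= telescope_sumr//; apply: lerD.
    have -> : m i * ((2 * s + 2 * del) / (2 * del)) =
      m i / (2 * del) * (2 * s + 2 * del) by ring.
    rewrite ler_wpM2l ?divr_ge0 ?mulr_ge0 ?(ltW mi0) ?(ltW del0)//.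
    have := clip_le (phi N); have := clip_ge (phi 0%N); lra.
  have s20 : 0 < s ^+ 2 by rewrite exprn_gt0.
  rewrite mulrC ler_pdivrMr//.
  have -> : 2^-1 * s ^+ 2 = 8 * a ^+ 2 * N%:R by rewrite /s -r2; field.
  apply: le_trans Q; rewrite /chain_mean big_nat_recr//= -[leLHS]addr0 lerD//.
    by apply: ler_sum_range => k _; rewrite expr1n mulr1.
  by rewrite mulr_ge0 ?(ltW (bd_m H _))// mulr_ge0 ?sqr_ge0.
have e : (2 * s + 2 * del) / (2 * del) = 1 + s / del.
  by field; rewrite gt_eqF.
have : 2^-1 <= m i * (2 + s / del) by move: tot; rewrite e; lra.
have -> : 2 + s / del = (2 * del + s) / del by field; rewrite gt_eqF.
rewrite mulrA ler_pdivlMr// => h.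
have : m i * (2 * del + s) <= m i * (2 * del * rN + s).
  by rewrite ler_pM2l// lerD2r ler_peMr// mulr_ge0 ?(ltW del0).
rewrite -/rN /s in h *; lra.
Qed.

(** The Gaussian lower bound on [m]: start from the mode and use [tail_lower_bound]
    to its right and, after exchanging the two sites, to its left. *)
Lemma mass_lower_bound (del a : R) : 0 < del -> exists K : R, 0 <= K /\
  forall N m B D k, (0 < N)%N -> birth_death del a N m B D -> (k <= N)%N ->
  - ln (m k) <= 2^-1 * ln N%:R + K * (1 + drift B D k ^+ 2 / N%:R).
Proof.
move=> del0; have [K [K0 HK]] := tail_lower_bound a del0.
have [a0|a0] := leP a 0.
  exists 0; split=> // N m B D k N0 H.
  by have := bd_a0 del0 N0 H; rewrite ltNge a0.
pose A := (4 * del + 8 * a) / del.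
have A1 : 1 <= A by rewrite ler_pdivlMr// mul1r; lra.
have A0 : 0 < A by lra.
have lA0 : 0 <= ln A by exact: ln_ge0.
exists (K + ln A); split; first exact: addr_ge0.
move=> N m B D k N0 H kN.
have [i iN imax] := exists_argmax m N.
have /andP[pi1 pi2] := mode_drift del0 N0 H iN imax.
have mi := mode_lower_bound del0 N0 H iN imax.
have mi0 := bd_m H iN.
have Nr0 : 0 < N%:R :> R by rewrite ltr0n.
have r0 : 0 < Num.sqrt N%:R :> R by rewrite sqrtr_gt0.
have lmi : - ln (m i) <= 2^-1 * ln N%:R + ln A.
  have : 0 <= ln (m i * (A * Num.sqrt N%:R)).
    apply: ln_ge0.
    have -> : m i * (A * Num.sqrt N%:R) =
      m i * ((4 * del + 8 * a) * Num.sqrt N%:R) / del by rewrite /A; ring.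
    by rewrite ler_pdivlMr// mul1r.
  have Ar0 : 0 < A * Num.sqrt N%:R by exact: mulr_gt0.
  rewrite lnM ?posrE// lnM ?posrE//.
  have -> : ln (Num.sqrt N%:R) = 2^-1 * ln N%:R :> R.
    by have := lnXn 2 r0; rewrite sqr_sqrtr ?ler0n// mulr2n => ->; field.
  lra.
have lik : ln (m i) - ln (m k) <= K * (1 + drift B D k ^+ 2 / N%:R).
  have [ik|/ltnW ki] := leqP i k; first by apply: (HK N m B D i k N0 H); rewrite ?ik.
  have := HK N _ _ _ (N - i)%N (N - k)%N N0 (birth_death_rev H).
  rewrite !subKn// leq_subr andbT leq_sub2l//.
  have e j : (j <= N)%N -> drift (fun k => D (N - k)%N) (fun k => B (N - k)%N)
      (N - j)%N = - drift B D j.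
    by move=> jN; rewrite /drift subKn// opprB.
  by rewrite !e// => /(_ isT); rewrite sqrrN; apply; rewrite lerN2.
have : ln A <= ln A * (1 + drift B D k ^+ 2 / N%:R).
  by rewrite ler_peMr// lerDl divr_ge0 ?sqr_ge0 ?(ltW Nr0).
lra.
Qed.

End LowerBound.

(** * The logarithmic Sobolev inequality for birth and death chains *)

Section LSI.
Context (R : realType).

Lemma chain_mean_ge0 N (m g : nat -> R) : (forall k, (k <= N)%N -> 0 < m k) ->
  (forall k, 0 <= g k) -> 0 <= chain_mean N m g.
Proof.
move=> m0 g0; apply: sumr_ge0_range => k /andP[_ kN].
by rewrite mulr_ge0// ltW// m0.
Qed.

Lemma chain_dirichlet_ge0 (del a : R) N m B D h : 0 < del -> (0 < N)%N ->
  birth_death del a N m B D -> 0 <= chain_dirichlet N m B h.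
Proof.
move=> del0 N0 H; apply: sumr_ge0_range => k /andP[_ /ltnW kN].
rewrite mulr_ge0 ?sqr_ge0// mulr_ge0 ?(ltW (bd_m H kN))//.
by have /andP[] := bd_Brange del0 N0 H kN.
Qed.

(** Write [ln (h^2) = ln (m h^2) - ln m].  The first logarithm is at most
    [- ln N / 2 + dir h] up to a constant, the second at most
    [ln N / 2 + C phi^2 / N] up to a constant: the terms in [ln N] cancel, and
    [E (phi^2 h^2) / N] is controlled by [phi2_bound]. *)
Lemma defective_lsi1 (del a : R) : 0 < del -> exists K : R, 0 <= K /\
  forall N m B D h, (0 < N)%N -> birth_death del a N m B D ->
  chain_mean N m (fun k => h k ^+ 2) = 1 ->
  chain_mean N m (fun k => h k ^+ 2 * ln (h k ^+ 2)) <= K * (1 + chain_dirichlet N m B h).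
Proof.
move=> del0; have [K [K0 HK]] := mass_lower_bound a del0.
pose A := 2 * (4 * a ^+ 2 + 4 * a + 2) / del.
have A0 : 0 < A by rewrite divr_gt0//; have := sqr_ge0 (2 * a + 1); lra.
exists (`|ln A| + K + 1 + K * (8 * a ^+ 2) + K * (6 * `|a|)); split.
  have q1 : 0 <= K * (8 * a ^+ 2) by apply: mulr_ge0 => //; rewrite mulr_ge0 ?sqr_ge0.
  have q2 : 0 <= K * (6 * `|a|) by apply: mulr_ge0 => //; rewrite mulr_ge0.
  by rewrite !addr_ge0.
move=> N m B D h N0 H Eh.
have a0 := bd_a0 del0 N0 H; rewrite (gtr0_norm a0).
set d := chain_dirichlet N m B h.
have d0 : 0 <= d by exact: chain_dirichlet_ge0 H.
have Nr0 : 0 < N%:R :> R by rewrite ltr0n.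
have r0 : 0 < Num.sqrt N%:R :> R by rewrite sqrtr_gt0.
have lnr : ln (Num.sqrt N%:R) = 2^-1 * ln N%:R :> R.
  by have := lnXn 2 r0; rewrite sqr_sqrtr ?ler0n// mulr2n => ->; field.
apply: (@le_trans _ _ (\sum_(0 <= k < N.+1) ((`|ln A| + d + K) * (m k * h k ^+ 2)
   + K / N%:R * (m k * (drift B D k ^+ 2 * h k ^+ 2))))).
  apply: ler_sum_range => k /andP[_ kN].
  have -> : (`|ln A| + d + K) * (m k * h k ^+ 2)
     + K / N%:R * (m k * (drift B D k ^+ 2 * h k ^+ 2)) =
     m k * (h k ^+ 2 * (`|ln A| + d + K * (1 + drift B D k ^+ 2 / N%:R))) by ring.
  rewrite ler_wpM2l ?(ltW (bd_m H kN))//.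
  have [->|hk] := eqVneq (h k) 0; first by rewrite expr0n !mul0r.
  have h20 : 0 < h k ^+ 2 by rewrite exprn_even_gt0.
  rewrite ler_pM2l//.
  have mk0 := bd_m H kN.
  have := density_bound del0 N0 H kN Eh; rewrite -/d => db.
  have {db} db : ln (m k * h k ^+ 2) <= ln (A * (1 + d) / Num.sqrt N%:R).
    rewrite ler_ln ?posrE ?(mulr_gt0 mk0)//; last first.
      by rewrite divr_gt0// mulr_gt0//; lra.
    rewrite ler_pdivlMr//.
    have -> : A * (1 + d) = 2 * (4 * a ^+ 2 + 4 * a + 2) * (1 + d) / del.
      by rewrite /A; ring.
    by rewrite ler_pdivlMr//; apply: le_trans db; rewrite le_eqVlt; apply/orP;
      left; apply/eqP; ring.
  have l1 : ln (1 + d) <= d by apply: le_ln1Dx; lra.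
  have d1 : 0 < 1 + d by lra.
  rewrite ln_div ?posrE ?(mulr_gt0 A0)// lnM ?posrE// lnM ?posrE// lnr in db.
  have := HK N m B D k N0 H kN; have := ler_norm (ln A); lra.
rewrite big_split/= -!big_distrr/=.
have Q := phi2_bound del0 N0 H h.
rewrite -/(chain_mean N m (fun k => h k ^+ 2)) Eh mulr1 in Q *.
rewrite -/(chain_mean N m (fun k => drift B D k ^+ 2 * h k ^+ 2)).
have KN : 0 <= K / N%:R by rewrite divr_ge0.
have := ler_wpM2l KN Q; rewrite -/d.
have -> : K / N%:R * (8 * a ^+ 2 * N%:R + 6 * a * N%:R * d) =
  K * (8 * a ^+ 2) + K * (6 * a) * d by field; rewrite gt_eqF.
have : 0 <= `|ln A| * d by rewrite mulr_ge0.
have : 0 <= K * d by rewrite mulr_ge0.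
have : 0 <= K * (8 * a ^+ 2) * d.
  by apply: mulr_ge0 => //; apply: mulr_ge0 => //; rewrite mulr_ge0 ?sqr_ge0.
have : 0 <= K * (6 * a) by apply: mulr_ge0 => //; rewrite mulr_ge0// ltW.
lra.
Qed.

Lemma defective_lsi (del a : R) : 0 < del -> exists K : R, 0 <= K /\
  forall N m B D h, (0 < N)%N -> birth_death del a N m B D ->
  chain_mean N m
    (fun k => h k ^+ 2 * ln (h k ^+ 2 / chain_mean N m (fun k => h k ^+ 2))) <=
  K * (chain_mean N m (fun k => h k ^+ 2) + chain_dirichlet N m B h).
Proof.
move=> del0; have [K [K0 HK]] := defective_lsi1 a del0.
exists K; split=> // N m B D h N0 H; set S := chain_mean N m (fun k => h k ^+ 2).
have S0 : 0 <= S by apply: chain_mean_ge0 (bd_m H) _ => k; exact: sqr_ge0.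
have [SE|SN] := eqVneq S 0.
  rewrite SE add0r {1}/chain_mean big_nat big1; last first.
    move=> k /andP[_ kN].
    suff -> : h k ^+ 2 = 0 by rewrite mul0r mulr0.
    have : m k * h k ^+ 2 <= S.
      rewrite /S /chain_mean big_mkord (bigD1 (Ordinal kN))//= lerDl.
      by apply: sumr_ge0 => i _; rewrite mulr_ge0 ?sqr_ge0// ltW// (bd_m H)// -ltnS.
    rewrite SE pmulr_rle0 ?(bd_m H)// => h0.
    by apply/eqP; rewrite eq_le h0 sqr_ge0.
  by rewrite mulr_ge0// (chain_dirichlet_ge0 _ del0 N0 H).
have Sp : 0 < S by rewrite lt_neqAle eq_sym SN.
pose g k := h k / Num.sqrt S.
have g2 k : g k ^+ 2 = h k ^+ 2 / S by rewrite expr_div_n sqr_sqrtr.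
have Eg : chain_mean N m (fun k => g k ^+ 2) = 1.
  rewrite /chain_mean; under eq_bigr do rewrite g2 mulrA.
  by rewrite -big_distrl/= -/(chain_mean N m (fun k => h k ^+ 2)) -/S divff.
have dg : chain_dirichlet N m B g = chain_dirichlet N m B h / S.
  rewrite /chain_dirichlet big_distrl/=; apply: eq_bigr => k _.
  by rewrite -mulrBl expr_div_n sqr_sqrtr// mulrA.
have := HK N m B D g N0 H Eg; rewrite dg.
have -> : chain_mean N m (fun k => g k ^+ 2 * ln (g k ^+ 2)) =
  chain_mean N m (fun k => h k ^+ 2 * ln (h k ^+ 2 / S)) / S.
  rewrite /chain_mean big_distrl/=; apply: eq_bigr => k _; rewrite g2; ring.
rewrite ler_pdivrMr//.
have -> : K * (1 + chain_dirichlet N m B h / S) * S = K * (S + chain_dirichlet N m B h).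
  by field; rewrite gt_eqF.
by [].
Qed.

(** The elementary inequality behind Rothaus' lemma.  It will be averaged with
    [mu] the mean and [V] the variance of [x]; the left-hand side
    vanishes to second order at [x = mu]. *)
Lemma rothaus_pointwise (mu x V : R) : 0 < mu -> 0 < x -> 0 < V ->
  V <= mu ^+ 2 ->
  x ^+ 2 * ln (x ^+ 2 / mu ^+ 2) - x ^+ 2 + mu ^+ 2 <=
  4 * ((x - mu) ^+ 2 * ln ((x - mu) ^+ 2 / V)) + 8 * (x - mu) ^+ 2 + 4 * V.
Proof.
move=> mu0 x0 V0 Vmu; set g := x - mu.
have mu20 : 0 < mu ^+ 2 by rewrite exprn_gt0.
have lnx : ln (x ^+ 2 / mu ^+ 2) = 2 * ln (x / mu).
  by rewrite -expr_div_n lnXn ?divr_gt0// mulr2n; ring.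
have gV : - V <= g ^+ 2 * ln (g ^+ 2 / V).
  have [->|g0] := eqVneq g 0; first by rewrite expr0n mul0r; lra.
  have g20 : 0 < g ^+ 2 by rewrite exprn_even_gt0.
  by have := xlnx_ge g20 V0; lra.
rewrite lnx.
have xmu : x / mu = 1 + g / mu by rewrite /g; field; rewrite gt_eqF.
have [gmu|gmu] := leP g mu.
  have l1 : ln (x / mu) <= g / mu.
    have := ln_leB1 (divr_gt0 x0 mu0); rewrite xmu; lra.
  have l2 : x ^+ 2 * (2 * ln (x / mu)) <= x ^+ 2 * (2 * (g / mu)).
    by rewrite ler_wpM2l ?sqr_ge0// ler_pM2l.
  have l3 : x ^+ 2 * (2 * (g / mu)) - x ^+ 2 + mu ^+ 2 =
     g ^+ 2 * (3 + 2 * (g / mu)).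
    by rewrite /g; field; rewrite gt_eqF.
  have l4 : g ^+ 2 * (3 + 2 * (g / mu)) <= g ^+ 2 * 5.
    rewrite ler_wpM2l ?sqr_ge0//.
    have : g / mu <= 1 by rewrite ler_pdivrMr// mul1r.
    lra.
  have := sqr_ge0 g; lra.
have g0 : 0 < g by exact: lt_trans gmu.
have x2g : x <= 2 * g by rewrite /g in gmu *; lra.
have x2 : x ^+ 2 <= 4 * g ^+ 2.
  have -> : 4 * g ^+ 2 = (2 * g) ^+ 2 by ring.
  by rewrite ler_sqr// nnegrE; lra.
have l1 : 0 <= ln (x / mu).
  by rewrite ln_ge0// ler_pdivlMr// mul1r; rewrite /g in g0; lra.
have l2 : ln (x / mu) <= ln (2 * (g / mu)).
  rewrite ler_ln ?posrE ?(divr_gt0 x0)// ?mulr_gt0 ?invr_gt0//.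
  by rewrite mulrA ler_pM2r ?invr_gt0.
have l3 : ln (2 * (g / mu)) = ln 2 + ln (g / mu).
  by rewrite lnM ?posrE ?(divr_gt0 g0).
have l4 : ln 2 <= 1 :> R by have := @ln_leB1 R 2; lra.
have l5 : 2 * ln (g / mu) <= ln (g ^+ 2 / V).
  have -> : 2 * ln (g / mu) = ln (g ^+ 2 / mu ^+ 2).
    by rewrite -expr_div_n lnXn ?divr_gt0// mulr2n; ring.
  have g20 : 0 < g ^+ 2 by rewrite exprn_gt0.
  by rewrite ler_ln ?posrE ?divr_gt0// ler_pM2l// lef_pV2 ?posrE.
have l6 : x ^+ 2 * (2 * ln (x / mu)) <= 4 * g ^+ 2 * (2 * ln (x / mu)).
  by rewrite ler_wpM2r// mulr_ge0.
have l7 : 4 * g ^+ 2 * (2 * ln (x / mu)) <= 4 * g ^+ 2 * (2 + ln (g ^+ 2 / V)).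
  by rewrite ler_wpM2l ?mulr_ge0 ?sqr_ge0//; lra.
have l8 : mu ^+ 2 <= x ^+ 2.
  by rewrite ler_sqr ?nnegrE ?(ltW x0) ?(ltW mu0)//; rewrite /g in g0; lra.
lra.
Qed.

(** The entropy of [f = h^2] is bounded by its variational form at [mu ^+ 2], with
    [mu] the mean of [h], and so by the entropy of [(h - mu)^2] plus a multiple
    of the variance of [h].  The defective inequality applied to [h - mu] then
    only involves the variance, hence the Dirichlet form.  If the variance
    exceeds [mu ^+ 2], then [E h^2] is at most twice the variance and the
    defective inequality for [h] suffices. *)
Theorem birth_death_lsi (del a : R) : 0 < del -> exists K : R, 0 <= K /\
  forall N m B D (f : nat -> R), (0 < N)%N -> birth_death del a N m B D ->
  (forall k, 0 < f k) ->
  wentropy (index_iota 0 N.+1) m f <= K * chain_dirichlet N m B (fun k => Num.sqrt (f k)).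
Proof.
move=> del0; have [K [K0 HK]] := defective_lsi a del0.
exists ((12 + 4 * K) / (2 * del) + 4 * K); split.
  by rewrite addr_ge0// ?divr_ge0// ?mulr_ge0 ?addr_ge0// ?mulr_ge0// ltW.
move=> N m B D f N0 H f0.
pose h k := Num.sqrt (f k); rewrite -/h.
have h0 k : 0 < h k by rewrite sqrtr_gt0.
have h2 k : h k ^+ 2 = f k by rewrite sqr_sqrtr// ltW.
pose mu := chain_mean N m h.
have mk k : k \in index_iota 0 N.+1 -> 0 < m k.
  by rewrite mem_index_iota => /andP[_ kN]; exact: (bd_m H).
have pos g : (forall k, 0 < g k) -> 0 < chain_mean N m g.
  by move=> g0; apply: sum_gt0_seq => // k kN; rewrite mulr_gt0// mk.
have mu0 : 0 < mu by exact: pos.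
have Sf0 := pos f f0.
have m1 := bd_m1 H.
have Z0 : 0 < \sum_(k <- index_iota 0 N.+1) m k by rewrite m1.
have entropy_le t : 0 < t ->
  wentropy (index_iota 0 N.+1) m f <= chain_mean N m (fun k => f k * ln (f k / t) - f k + t).
  by move=> t0; exact: wentropy_le_ref.
pose V := chain_mean N m (fun k => (h k - mu) ^+ 2).
have VE : V = chain_mean N m f - mu ^+ 2.
  transitivity (\sum_(0 <= k < N.+1) (m k * f k - 2 * mu * (m k * h k) + mu ^+ 2 * m k)).
    by apply: eq_bigr => k _; rewrite -h2; ring.
  rewrite big_split/= sumrB -!big_distrr/= m1 -/(chain_mean N m f) -/(chain_mean N m h) -/mu.
  ring.
set d := chain_dirichlet N m B h.
have d0 : 0 <= d by exact: chain_dirichlet_ge0 H.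
have Ef : chain_mean N m (fun k => h k ^+ 2) = chain_mean N m f.
  by apply: eq_bigr => k _; rewrite h2.
have Vd : V <= d / (2 * del).
  have := poincare del0 N0 H h; rewrite Ef -/mu -VE -/d => hh.
  by rewrite ler_pdivlMr ?mulr_gt0// mulrC.
have V0 : 0 <= V by apply: chain_mean_ge0 (bd_m H) _ => k; exact: sqr_ge0.
have Kd : 0 <= K * d by rewrite mulr_ge0.
have KV : K * V <= K * (d / (2 * del)) by rewrite ler_wpM2l.
have KV0 : 0 <= K * V by rewrite mulr_ge0.
have -> : ((12 + 4 * K) / (2 * del) + 4 * K) * d =
  12 * (d / (2 * del)) + 4 * (K * (d / (2 * del))) + 4 * (K * d) by ring.
have [Vmu|Vmu] := leP V (mu ^+ 2); last first.
  have := HK N m B D h N0 H; rewrite Ef => hk.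
  have e : chain_mean N m (fun k => f k * ln (f k / chain_mean N m f) - f k + chain_mean N m f) =
    chain_mean N m (fun k => h k ^+ 2 * ln (h k ^+ 2 / chain_mean N m f)).
    set S := chain_mean N m f.
    transitivity (\sum_(0 <= k < N.+1)
       (m k * (h k ^+ 2 * ln (h k ^+ 2 / S)) - m k * f k + S * m k)).
      by apply: eq_bigr => k _; rewrite -h2; ring.
    rewrite big_split/= sumrB -big_distrr/= m1 -/(chain_mean N m f) -/S.
    by rewrite mulr1 subrK.
  apply: le_trans (entropy_le _ Sf0) _; rewrite e; apply: le_trans hk _.
  have : K * chain_mean N m f <= K * (2 * V) by rewrite ler_wpM2l//; lra.
  rewrite -/d; lra.
have [V00|VN] := eqVneq V 0.
  have hmu k : (k <= N)%N -> f k = mu ^+ 2.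
    move=> kN; suff : (h k - mu) ^+ 2 = 0.
      by move/eqP; rewrite sqrf_eq0 subr_eq0 -h2 => /eqP ->.
    have : m k * (h k - mu) ^+ 2 <= V.
      rewrite /V /chain_mean big_mkord.
      rewrite (bigD1 (Ordinal (kN : (k < N.+1)%N)))//= lerDl.
      by apply: sumr_ge0 => i _; rewrite mulr_ge0 ?sqr_ge0// ltW// (bd_m H)// -ltnS.
    rewrite V00 pmulr_rle0 ?(bd_m H)// => hh.
    by apply/eqP; rewrite eq_le hh sqr_ge0.
  apply: le_trans (entropy_le _ (exprn_gt0 2 mu0)) _.
  rewrite /chain_mean big_nat big1; last first.
    move=> k /andP[_ kN]; rewrite (hmu k kN) divff ?gt_eqF ?exprn_gt0// ln1.
    by rewrite mulr0 sub0r addNr mulr0.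
  by have := le_trans V0 Vd; have := le_trans KV0 KV; lra.
have Vp : 0 < V by rewrite lt_neqAle eq_sym VN.
apply: le_trans (entropy_le _ (exprn_gt0 2 mu0)) _.
apply: (@le_trans _ _ (\sum_(0 <= k < N.+1)
  (4 * (m k * ((h k - mu) ^+ 2 * ln ((h k - mu) ^+ 2 / V))) +
   8 * (m k * (h k - mu) ^+ 2) + 4 * V * m k))).
  apply: ler_sum_range => k /andP[_ kN].
  have mk0 := bd_m H (kN : (k <= N)%N).
  have := ler_wpM2l (ltW mk0) (rothaus_pointwise mu0 (h0 k) Vp Vmu).
  rewrite h2 => /le_trans; apply; rewrite le_eqVlt; apply/orP; left; apply/eqP; ring.
rewrite !big_split/= -!big_distrr/= m1 mulr1.
have := HK N m B D (fun k => h k - mu) N0 H; rewrite -/V.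
have -> : chain_dirichlet N m B (fun k => h k - mu) = d.
  by apply: eq_bigr => k _; congr (_ * _ ^+ 2); ring.
rewrite /chain_mean => hk.
have -> : \sum_(0 <= i < N.+1) m i * (h i - mu) ^+ 2 = V by [].
lra.
Qed.

End LSI.

(** * Two sites *)

Section Rates.
Context (R : realType).

(** A single-site weight [u], proportional to [1 / c(k)!], together with its rate
    [c]: the monotone case of the zero-range process. *)
Record rated (del a : R) (u c : nat -> R) : Prop := Rated {
  rt_pos : forall k, 0 < u k;
  rt_c0 : c 0%N = 0;
  rt_rev : forall k, u k = c k.+1 * u k.+1;
  rt_inc : forall k, del <= c k.+1 - c k <= a }.

Lemma rated_mono del a u c : 0 <= del -> rated del a u c ->
  forall i j, (i <= j)%N -> c i <= c j.
Proof.
move=> del0 H i j; elim: j => [|j IH]; first by rewrite leqn0 => /eqP ->.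
rewrite leq_eqVlt => /predU1P[->//|/IH]; have := rt_inc H j; lra.
Qed.

Lemma rated_logconcave del a u c : 0 <= del -> rated del a u c ->
  forall p q, (p <= q)%N -> u p * u q.+1 <= u p.+1 * u q.
Proof.
move=> del0 H p q pq; rewrite [u p](rt_rev H) [u q](rt_rev H).
rewrite [leRHS]mulrCA -mulrA ler_wpM2r ?(rated_mono del0 H)//.
by rewrite mulr_ge0// ltW// (rt_pos H).
Qed.

(** The partition function of two sites. *)
Definition convolution (u v : nat -> R) (M : nat) : R :=
  \sum_(0 <= k < M.+1) u k * v (M - k)%N.

Lemma convolution_gt0 (u v : nat -> R) M :
  (forall k, 0 < u k) -> (forall k, 0 < v k) -> 0 < convolution u v M.
Proof. by move=> u0 v0; apply: sum_gt0_seq => // k _; exact: mulr_gt0. Qed.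

Lemma summation_by_parts (x G : nat -> R) n :
  \sum_(0 <= k < n.+1) x k * G k = (\sum_(0 <= k < n.+1) x k) * G 0%N +
    \sum_(0 <= k < n) (\sum_(k.+1 <= i < n.+1) x i) * (G k.+1 - G k).
Proof.
elim: n => [|n IH]; first by rewrite !big_nat1 big_geq// addr0.
rewrite big_nat_recr//= IH [X in _ = X * _ + _]big_nat_recr//=.
rewrite [X in _ = _ + X]big_nat_recr//= big_nat1.
have -> : \sum_(0 <= k < n) (\sum_(k.+1 <= i < n.+2) x i) * (G k.+1 - G k) =
  \sum_(0 <= k < n) (\sum_(k.+1 <= i < n.+1) x i) * (G k.+1 - G k) +
  x n.+1 * (G n - G 0%N).
  rewrite -(telescope_sumr G (leq0n n)) big_distrr/= -big_split/=.
  apply: eq_big_nat => k /andP[_ kn].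
  by rewrite big_nat_recr ?ltnS ?(ltnW kn)//= mulrDl.
ring.
Qed.

(** Monotone likelihood ratio implies stochastic domination. *)
Lemma tail_domination (x y : nat -> R) k n : (k <= n)%N ->
  (forall j i, (j < k <= i)%N -> (i < n)%N -> x i * y j <= y i * x j) ->
  (\sum_(k <= i < n) x i) * (\sum_(0 <= j < n) y j) <=
  (\sum_(k <= i < n) y i) * (\sum_(0 <= j < n) x j).
Proof.
move=> kn xy; rewrite !(big_cat_nat (leq0n k) kn)/= !mulrDr.
rewrite [(\sum_(k <= i < n) x i) * (\sum_(k <= i < n) y i)]mulrC lerD2r.
rewrite !big_distrlr/=; apply: ler_sum_range => i /andP[ki iN].
by apply: ler_sum_range => j /andP[_ jk]; apply: xy; rewrite ?jk.
Qed.

(** Adding one particle to a two-site configuration [(k, M - k)], at the first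
    site with probability [p M k].  The tails of the first occupation determine
    [p], which lies between 0 and 1 because the laws with [M] and [M + 1]
    particles have monotone likelihood ratios, both before and after shifting by
    one: that is the log-concavity of [u] and [v]. *)
Lemma two_site_coupling del a u c v b : 0 <= del ->
  rated del a u c -> rated del a v b -> exists p : nat -> nat -> R,
  (forall M k, (k <= M)%N -> 0 <= p M k <= 1) /\
  forall M G, convolution u v M * (\sum_(0 <= k < M.+2) u k * v (M.+1 - k)%N * G k) =
    convolution u v M.+1 * (\sum_(0 <= k < M.+1)
       u k * v (M - k)%N * (p M k * G k.+1 + (1 - p M k) * G k)).
Proof.
move=> del0 Hu Hv; have u0 := rt_pos Hu; have v0 := rt_pos Hv.
pose x M k := u k * v (M - k)%N.
have x0 M k : 0 < x M k by exact: mulr_gt0.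
pose T M k := \sum_(k <= i < M.+1) x M i.
pose p M k := (T M.+1 k.+1 * convolution u v M - T M k.+1 * convolution u v M.+1) /
  (convolution u v M.+1 * x M k).
have Z0 M : 0 < convolution u v M by exact: convolution_gt0.
exists p; split; last first.
  move=> M G.
  rewrite (summation_by_parts (fun k => u k * v (M.+1 - k)%N)) -/(convolution u v M.+1).
  transitivity (convolution u v M.+1 * (\sum_(0 <= k < M.+1) x M k * G k) +
     \sum_(0 <= k < M.+1) (T M.+1 k.+1 * convolution u v M - T M k.+1 * convolution u v M.+1)
       * (G k.+1 - G k)).
    rewrite (summation_by_parts (x M)) -/(convolution u v M).
    have -> : \sum_(0 <= k < M) (\sum_(k.+1 <= i < M.+1) x M i) * (G k.+1 - G k)
       = \sum_(0 <= k < M.+1) T M k.+1 * (G k.+1 - G k).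
      by rewrite big_nat_recr//= [T M M.+1]big_geq// mul0r addr0.
    have -> : \sum_(0 <= k < M.+1)
        (T M.+1 k.+1 * convolution u v M - T M k.+1 * convolution u v M.+1) * (G k.+1 - G k) =
      convolution u v M * (\sum_(0 <= k < M.+1) T M.+1 k.+1 * (G k.+1 - G k)) -
      convolution u v M.+1 * (\sum_(0 <= k < M.+1) T M k.+1 * (G k.+1 - G k)).
      by rewrite !big_distrr/= -sumrB; apply: eq_bigr => k _; ring.
    by rewrite /T /x; ring.
  rewrite !big_distrr/= -big_split/=; apply: eq_bigr => k _; rewrite /p -/(x M k).
  by field; rewrite !gt_eqF.
move=> M k kM; have T0 N i : 0 <= T N i.
  by apply: sumr_ge0_range => j _; exact: ltW.
have d0 : 0 < convolution u v M.+1 * x M k by exact: mulr_gt0.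
apply/andP; split.
  rewrite divr_ge0 ?(ltW d0)// subr_ge0.
  have := @tail_domination (x M) (x M.+1) k.+1 M.+1.
  rewrite ltnS kM => /(_ isT) h.
  have {}h : T M k.+1 * (\sum_(0 <= j < M.+1) x M.+1 j) <=
     (\sum_(k.+1 <= i < M.+1) x M.+1 i) * convolution u v M.
    apply: h => j i /andP[jk ki] iM.
    have ji : (j < i)%N by exact: leq_trans jk ki.
    have jM : (j <= M)%N by rewrite -ltnS (ltn_trans ji).
    have := rated_logconcave del0 Hv (leq_sub2l M (ltnW ji)).
    rewrite -!subSn// /x => h'.
    have -> : u i * v (M - i)%N * (u j * v (M.+1 - j)%N) =
      (u i * u j) * (v (M - i)%N * v (M.+1 - j)%N) by ring.
    have -> : u i * v (M.+1 - i)%N * (u j * v (M - j)%N) =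
      (u i * u j) * (v (M.+1 - i)%N * v (M - j)%N) by ring.
    by rewrite ler_wpM2l// mulr_ge0// ltW.
  have -> : T M.+1 k.+1 = (\sum_(k.+1 <= i < M.+1) x M.+1 i) + x M.+1 M.+1.
    by rewrite /T big_nat_recr.
  have -> : convolution u v M.+1 = (\sum_(0 <= j < M.+1) x M.+1 j) + x M.+1 M.+1.
    by rewrite /convolution big_nat_recr.
  have : T M k.+1 * x M.+1 M.+1 <= convolution u v M * x M.+1 M.+1.
    rewrite ler_wpM2r ?(ltW (x0 _ _))// /convolution (big_cat_nat (leq0n k.+1))//=.
    by rewrite lerDr; apply: sumr_ge0_range => i _; exact: (ltW (x0 M i)).
  by move: h; rewrite !mulrDl !mulrDr; lra.
rewrite ler_pdivrMr// mul1r.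
have := @tail_domination (fun i => x M.+1 i.+1) (x M) k M.+1.
rewrite leqW// => /(_ isT) h.
have {}h : (\sum_(k <= i < M.+1) x M.+1 i.+1) * convolution u v M <=
   T M k * (\sum_(0 <= j < M.+1) x M.+1 j.+1).
  apply: h => j i /andP[jk ki] iM; rewrite /x !subSS.
  have h' := rated_logconcave del0 Hu (ltnW (leq_trans jk ki)).
  have -> : u i.+1 * v (M - i)%N * (u j * v (M - j)%N) =
    (u j * u i.+1) * (v (M - i)%N * v (M - j)%N) by ring.
  have -> : u i * v (M - i)%N * (u j.+1 * v (M - j)%N) =
    (u j.+1 * u i) * (v (M - i)%N * v (M - j)%N) by ring.
  by rewrite ler_wpM2r// mulr_ge0// ltW.
have T1 : T M.+1 k.+1 = \sum_(k <= i < M.+1) x M.+1 i.+1 by rewrite /T big_add1.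
have T2 : T M k = x M k + T M k.+1 by rewrite /T big_ltn.
have Z2 : \sum_(0 <= j < M.+1) x M.+1 j.+1 <= convolution u v M.+1.
  have -> : convolution u v M.+1 = x M.+1 0%N + \sum_(0 <= j < M.+1) x M.+1 j.+1.
    by rewrite /convolution big_nat_recl.
  by rewrite lerDr ltW.
have := ler_wpM2l (T0 M k) Z2.
rewrite -T1 in h; rewrite T2 in h *; lra.
Qed.

(** The rate that makes the convolution of [u] and [v] a single-site weight; it
    is the mean of the rate of either site ([lumped_rate_l], [lumped_rate_r]). *)
Definition lumped_rate (u v : nat -> R) (M : nat) : R :=
  if M is M'.+1 then convolution u v M' / convolution u v M else 0.

Lemma lumped_rate_l del a u c v M : rated del a u c -> (forall k, 0 < v k) ->
  \sum_(0 <= k < M.+1) u k * v (M - k)%N * c k = lumped_rate u v M * convolution u v M.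
Proof.
move=> H v0; rewrite big_nat_recl// (rt_c0 H) mulr0 add0r.
case: M => [|M]; first by rewrite big_geq// mul0r.
rewrite /= divfK ?gt_eqF ?convolution_gt0//; last exact: rt_pos H.
by apply: eq_bigr => k _; rewrite subSS [u k](rt_rev H); ring.
Qed.

Lemma convolutionC (u v : nat -> R) M : convolution u v M = convolution v u M.
Proof.
rewrite /convolution big_nat_rev/=; apply: eq_big_nat => k /andP[_ kM].
by rewrite add0n subSS subKn// mulrC.
Qed.

Lemma lumped_rate_r del a u v b M : rated del a v b -> (forall k, 0 < u k) ->
  \sum_(0 <= k < M.+1) u k * v (M - k)%N * b (M - k)%N =
  lumped_rate u v M * convolution u v M.
Proof.
move=> H u0; have := lumped_rate_l M H u0.
have -> : lumped_rate v u M * convolution v u M = lumped_rate u v M * convolution u v M.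
  by case: M => [|M]; rewrite /lumped_rate ![convolution v u _]convolutionC ?mul0r.
move=> <-; rewrite big_nat_rev/=; apply: eq_big_nat => k /andP[_ kM].
by rewrite add0n subSS subKn//; ring.
Qed.

(** The increment of the lumped rate is the mean of the increment of [c] on the
    event that the added particle falls on the first site, and also the mean of
    that of [b] on the complementary event.  One of these events has probability
    at least one half. *)
Lemma convolution_rated del a u c v b : 0 < del ->
  rated del a u c -> rated del a v b ->
  rated (del / 2) a (convolution u v) (lumped_rate u v).
Proof.
move=> del0 Hu Hv; have u0 := rt_pos Hu; have v0 := rt_pos Hv.
have [p [p01 cpl]] := two_site_coupling (ltW del0) Hu Hv.
have Z0 M : 0 < convolution u v M by exact: convolution_gt0.
split=> // M; first by rewrite /= divfK// gt_eqF.
pose w k := u k * v (M - k)%N.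
have w0 k : 0 < w k by exact: mulr_gt0.
set C := lumped_rate u v.
pose P := \sum_(0 <= k < M.+1) w k * p M k.
have P0 : 0 <= P.
  apply: sumr_ge0_range => k /andP[_ kM]; rewrite mulr_ge0 ?(ltW (w0 k))//.
  by have /andP[] := p01 M k kM.
have PZ : \sum_(0 <= k < M.+1) w k * (1 - p M k) = convolution u v M - P.
  by rewrite -sumrB; apply: eq_bigr => k _; rewrite mulrBr mulr1.
have P1 : 0 <= convolution u v M - P.
  rewrite -PZ; apply: sumr_ge0_range => k /andP[_ kM].
  by rewrite mulr_ge0 ?(ltW (w0 k))// subr_ge0; have /andP[] := p01 M k kM.
have inc1 : (C M.+1 - C M) * convolution u v M =
    \sum_(0 <= k < M.+1) w k * p M k * (c k.+1 - c k).
  have := cpl M c; rewrite (lumped_rate_l _ Hu v0) -/C mulrCA [C _ * _]mulrC -mulrA.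
  rewrite -mulrCA => /(mulfI (lt0r_neq0 (Z0 M.+1))) e.
  rewrite mulrBl mulrC in e *; rewrite e -(lumped_rate_l M Hu v0) -sumrB.
  by apply: eq_bigr => k _; rewrite /w; ring.
have inc2 : (C M.+1 - C M) * convolution u v M =
    \sum_(0 <= k < M.+1) w k * (1 - p M k) * (b (M - k).+1 - b (M - k)%N).
  have := cpl M (fun k => b (M.+1 - k)%N).
  rewrite (lumped_rate_r _ Hv u0) -/C mulrCA [C _ * _]mulrC -mulrA.
  rewrite -mulrCA => /(mulfI (lt0r_neq0 (Z0 M.+1))) e.
  rewrite mulrBl mulrC in e *; rewrite e -(lumped_rate_r M Hv u0) -sumrB.
  apply: eq_big_nat => k /andP[_ kM]; rewrite subSS (subSn (kM : (k <= M)%N)) /w; ring.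
have b1 : del * P <= (C M.+1 - C M) * convolution u v M <= a * P.
  rewrite inc1 /P !big_distrr/=; apply/andP; split;
  apply: ler_sum_range => k /andP[_ kM]; have /andP[h1 h2] := rt_inc Hu k;
  have /andP[p0 _] := p01 M k kM;
  have wp := mulr_ge0 (ltW (w0 k)) p0.
    by rewrite mulrC ler_wpM2l.
  by rewrite [leRHS]mulrC ler_wpM2l.
have b2 : del * (convolution u v M - P) <= (C M.+1 - C M) * convolution u v M.
  rewrite inc2 -PZ big_distrr/=.
  apply: ler_sum_range => k /andP[_ kM]; have /andP[h1 h2] := rt_inc Hv (M - k)%N.
  have /andP[_ p1] := p01 M k kM.
  by rewrite mulrC ler_wpM2l// mulr_ge0 ?(ltW (w0 k))// subr_ge0.
have a0 : 0 <= a by have := rt_inc Hu 0%N; lra.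
move/andP: b1 => [b1 b3].
apply/andP; split; rewrite -(ler_pM2r (Z0 M)); first by lra.
by have := mulr_ge0 a0 P1; lra.
Qed.

Lemma wentropy_scale (T : Type) (r : seq T) (W f : T -> R) s : s != 0 ->
  wentropy r (fun x => s * W x) f = s * wentropy r W f.
Proof.
move=> s0; rewrite /wentropy.
have e (g : T -> R) : \sum_(x <- r) s * W x * g x = s * \sum_(x <- r) W x * g x.
  by rewrite big_distrr/=; apply: eq_bigr => x _; rewrite mulrA.
rewrite !e -big_distrr/= -mulf_div divff// mul1r; ring.
Qed.

Lemma two_site_lsi (del a : R) : 0 < del -> exists K : R, 0 <= K /\
  forall u c v b N (f : nat -> R),
  rated del a u c -> rated del a v b -> (forall k, 0 < f k) ->
  wentropy (index_iota 0 N.+2) (fun k => u k * v (N.+1 - k)%N) f <=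
  K * \sum_(0 <= k < N.+1) u k * v (N - k)%N *
      (Num.sqrt (f k.+1) - Num.sqrt (f k)) ^+ 2.
Proof.
move=> del0; have [K [K0 HK]] := birth_death_lsi a del0.
exists K; split=> // u c v b N f Hu Hv f0.
have u0 := rt_pos Hu; have v0 := rt_pos Hv.
have Z0 : 0 < convolution u v N.+1 by exact: convolution_gt0.
set Z := convolution u v N.+1 in Z0.
have H : birth_death del a N.+1 (fun k => Z^-1 * (u k * v (N.+1 - k)%N))
    (fun k => b (N.+1 - k)%N) c.
  split.
  - by move=> k _; rewrite mulr_gt0 ?invr_gt0 ?mulr_gt0.
  - by rewrite -big_distrr/= mulVf// gt_eqF.
  - move=> k kN; rewrite subSS (subSn (kN : (k <= N)%N)) [v (N - k)%N](rt_rev Hv).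
    by rewrite [u k](rt_rev Hu); ring.
  - exact: (rt_c0 Hu).
  - by rewrite subnn (rt_c0 Hv).
  - by move=> k _; exact: (rt_inc Hu).
  - by move=> k kN; rewrite subSS (subSn (kN : (k <= N)%N)); exact: (rt_inc Hv).
have := HK _ _ _ _ f (ltn0Sn N) H f0.
rewrite wentropy_scale ?invr_eq0 ?gt_eqF//.
rewrite -(ler_pM2l Z0) mulrA mulfV ?gt_eqF// mul1r => /le_trans; apply.
rewrite mulrCA ler_wpM2l// /chain_dirichlet big_distrr/= le_eqVlt; apply/orP; left.
apply/eqP; apply: eq_big_nat => k /andP[_ kN].
rewrite (subSn (kN : (k <= N)%N)) [v (N - k)%N](rt_rev Hv).
by field; rewrite gt_eqF.
Qed.

End Rates.

(** * Finitely many sites on the complete graph *)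

(** Configurations of [N] particles on [n] sites are sequences of occupation
    numbers, which makes the induction on the number of sites structural. *)
Fixpoint confs (n N : nat) : seq (seq nat) :=
  if n is n'.+1 then
    [seq k :: s | k <- index_iota 0 N.+1, s <- confs n' (N - k)]
  else if N == 0%N then [:: [::]] else [::].

Lemma mem_confs n N s : (s \in confs n N) = (size s == n) && (sumn s == N).
Proof.
elim: n N s => [|n IH] N s.
  by case: s => [|k s] /=; case: N => // N; rewrite ?inE.
apply/allpairsPdep/idP => [[k [t [kN tn ->]]]|].
  move: kN tn; rewrite mem_index_iota IH /= eqSS ltnS => kN /andP[-> /eqP ->].
  by rewrite subnKC ?eqxx// -ltnS.
case: s => [|k s] //= /andP[sn /eqP <-]; exists k, s.
split=> //; first by rewrite mem_index_iota ltnS leq_addr.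
by rewrite IH addKn eqxx andbT.
Qed.

Lemma uniq_confs n N : uniq (confs n N).
Proof.
elim: n N => [|n IH] N; first by case: N.
apply: allpairs_uniq_dep => //; first exact: iota_uniq.
by move=> [k s] [k' s'] _ _ /= [-> ->].
Qed.

Section ManySites.
Context (R : realType).

Definition sweight (u : nat -> R) (s : seq nat) : R := \prod_(k <- s) u k.

Definition seq_partition (u : nat -> R) (n N : nat) : R :=
  \sum_(s <- confs n N) sweight u s.

(** The Dirichlet form of the complete graph, for the unnormalised measure.
    Writing a configuration before a jump as [s] plus the jumping particle
    absorbs the rate into the weight: [u k.+1 * c k.+1 = u k]. *)
Definition complete_dirichlet (u : nat -> R) (n N : nat) (h : seq nat -> R) : R :=
  \sum_(s <- confs n N) sweight u s *
    \sum_(0 <= i < n) \sum_(0 <= j < n) (h (incr_nth s i) - h (incr_nth s j)) ^+ 2.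

Lemma sum_confsS (u : nat -> R) n N (F : seq nat -> R) :
  \sum_(s <- confs n.+1 N) sweight u s * F s =
  \sum_(0 <= k < N.+1) u k *
    \sum_(s <- confs n (N - k)) sweight u s * F (k :: s).
Proof.
rewrite big_allpairs_dep/=; apply: eq_bigr => k _; rewrite big_distrr/=.
by apply: eq_bigr => s _; rewrite /sweight big_cons mulrA.
Qed.

Lemma sum_confs1 (u : nat -> R) N (F : seq nat -> R) :
  \sum_(s <- confs 1 N) sweight u s * F s = u N * F [:: N].
Proof.
rewrite sum_confsS big_nat_recr//= big_nat big1 ?add0r; last first.
  move=> k /andP[_ kN]; rewrite subn_eq0 leqNgt kN/= big_nil mulr0//.
by rewrite subnn/= big_seq1 /sweight big_nil mul1r.
Qed.

Lemma seq_partition1 (u : nat -> R) : seq_partition u 1 = u.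
Proof.
apply/funext => N; rewrite /seq_partition.
by have := sum_confs1 u N (fun=> 1); under eq_bigr do rewrite mulr1; rewrite mulr1.
Qed.

Lemma seq_partitionS (u : nat -> R) n : seq_partition u n.+1 = convolution u (seq_partition u n).
Proof.
apply/funext => N; rewrite /seq_partition /convolution.
transitivity (\sum_(s <- confs n.+1 N) sweight u s * 1).
  by apply: eq_bigr => s _; rewrite mulr1.
rewrite sum_confsS; apply: eq_bigr => k _; congr (_ * _).
by apply: eq_bigr => s _; rewrite mulr1.
Qed.

Lemma rated_weaken (del del' a : R) u c : del' <= del ->
  rated del a u c -> rated del' a u c.
Proof.
move=> dd [u0 c0 rev inc]; split=> // k.
by have /andP[h ->] := inc k; rewrite (le_trans dd h).
Qed.

(** A group of sites is a site: iterate [convolution_rated]. *)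
Lemma seq_partition_rated (del a : R) u c n : 0 < del -> rated del a u c ->
  exists b, rated (del / 2 ^+ n) a (seq_partition u n.+1) b.
Proof.
move=> del0 H; elim: n => [|n [b IH]].
  by exists c; rewrite expr0 divr1 seq_partition1.
have dn0 : 0 < del / 2 ^+ n by rewrite divr_gt0// exprn_gt0.
exists (lumped_rate u (seq_partition u n.+1)).
rewrite seq_partitionS exprSr invfM mulrA.
apply: convolution_rated IH => //; apply: rated_weaken H.
by rewrite ler_pdivrMr ?exprn_gt0// ler_peMr ?(ltW del0)// exprn_ege1// ler1n.
Qed.

Lemma sweight_gt0 (u : nat -> R) s : (forall k, 0 < u k) -> 0 < sweight u s.
Proof. by move=> u0; exact: prodr_gt0. Qed.

(** The law with [M.+1] particles is obtained from the one with [M] by adding one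
    particle, at site [j] with probability [q M s j].  The two-site coupling
    decides between the first site and the group of the others, inside which the
    coupling given by induction is used. *)
Lemma monotone_coupling (del a : R) u c n : 0 < del -> rated del a u c ->
  exists q : nat -> seq nat -> nat -> R,
  (forall M s, s \in confs n.+1 M ->
     (forall j, 0 <= q M s j) /\ \sum_(0 <= j < n.+1) q M s j = 1) /\
  forall M (g : seq nat -> R),
    seq_partition u n.+1 M * \sum_(s <- confs n.+1 M.+1) sweight u s * g s =
    seq_partition u n.+1 M.+1 * \sum_(s <- confs n.+1 M) sweight u s *
       \sum_(0 <= j < n.+1) q M s j * g (incr_nth s j).
Proof.
move=> del0 H; have u0 := rt_pos H.
elim: n => [|n [q [q01 cpl]]].
  exists (fun _ _ _ => 1); split=> [M s _|M g].
    by split=> [j|]; [exact: ler01|rewrite big_nat1].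
  rewrite !sum_confs1 seq_partition1 big_nat1 mul1r/=; ring.
have [b Hv] := seq_partition_rated n del0 H.
set v := seq_partition u n.+1 in Hv cpl; have v0 := rt_pos Hv.
have dn0 : 0 < del / 2 ^+ n by rewrite divr_gt0// exprn_gt0.
have Hu : rated (del / 2 ^+ n) a u c.
  apply: rated_weaken H.
  by rewrite ler_pdivrMr ?exprn_gt0// ler_peMr ?(ltW del0)// exprn_ege1// ler1n.
have [p [p01 cpl2]] := two_site_coupling (ltW dn0) Hu Hv.
pose q' M s j := if s is k :: t then
   if j is j'.+1 then (1 - p M k) * q (M - k)%N t j' else p M k else 0.
exists q'; split=> [M s|M g].
  case: s => [|k s]; first by rewrite mem_confs.
  rewrite mem_confs /= eqSS => /andP[ns /eqP sM].
  have kM : (k <= M)%N by rewrite -sM leq_addr.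
  have sin : s \in confs n.+1 (M - k) by rewrite mem_confs ns -sM addKn eqxx.
  have [q0 q1] := q01 _ _ sin; have /andP[p0 p1] := p01 M k kM.
  split=> [[|j]//|]; first by rewrite mulr_ge0// subr_ge0.
  by rewrite big_nat_recl//= -big_distrr/= q1 mulr1 addrC subrK.
rewrite seq_partitionS -/v !sum_confsS.
pose S N k := \sum_(s <- confs n.+1 (N - k)) sweight u s * g (k :: s).
pose G k := S M.+1 k / v (M.+1 - k)%N.
have := cpl2 M G.
have -> : \sum_(0 <= k < M.+2) u k * v (M.+1 - k)%N * G k =
   \sum_(0 <= k < M.+2) u k * S M.+1 k.
  by apply: eq_bigr => k _; rewrite /G; field; rewrite gt_eqF.
move=> ->; congr (_ * _); apply: eq_big_nat => k /andP[_ kM].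
rewrite -mulrA; congr (_ * _).
have -> : v (M - k)%N * (p M k * G k.+1 + (1 - p M k) * G k) =
   p M k * (v (M - k)%N * G k.+1) + (1 - p M k) * (v (M - k)%N * G k) by ring.
have -> : v (M - k)%N * G k.+1 =
    \sum_(s <- confs n.+1 (M - k)) sweight u s * g (k.+1 :: s).
  by rewrite /G /S subSS; field; rewrite gt_eqF.
have -> : v (M - k)%N * G k = \sum_(s <- confs n.+1 (M - k)) sweight u s *
     \sum_(0 <= j < n.+1) q (M - k)%N s j * g (k :: incr_nth s j).
  have := cpl (M - k)%N (fun s => g (k :: s)).
  rewrite /G /S (subSn (kM : (k <= M)%N)) => e.
  apply: (mulfI (lt0r_neq0 (v0 (M - k).+1))); rewrite -e.
  by field; rewrite gt_eqF.
rewrite !big_distrr/= -big_split/=; apply: eq_bigr => s _.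
rewrite [X in _ = _ * X]big_nat_recl//=.
under [X in _ = _ * (_ + X)]eq_bigr do rewrite -mulrA.
by rewrite -big_distrr/=; ring.
Qed.

(** The chain rule: condition on the occupation of the first site. *)
Lemma wentropy_chain (u : nat -> R) n N (f : seq nat -> R) :
  (forall k, 0 < seq_partition u n k) ->
  let F k := (\sum_(s <- confs n (N - k)) sweight u s * f (k :: s)) /
             seq_partition u n (N - k) in
  wentropy (confs n.+1 N) (sweight u) f =
  \sum_(0 <= k < N.+1)
     u k * wentropy (confs n (N - k)) (sweight u) (fun s => f (k :: s)) +
  wentropy (index_iota 0 N.+1) (fun k => u k * seq_partition u n (N - k)) F.
Proof.
move=> v0 F; rewrite /wentropy !sum_confsS.
have e1 (g : nat -> R) :
    \sum_(0 <= k < N.+1) u k * seq_partition u n (N - k) * (F k * g k) =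
    \sum_(0 <= k < N.+1) u k *
      ((\sum_(s <- confs n (N - k)) sweight u s * f (k :: s)) * g k).
  by apply: eq_bigr => k _; rewrite /F; field; rewrite gt_eqF.
have e2 : \sum_(0 <= k < N.+1) u k * seq_partition u n (N - k) * F k =
  \sum_(0 <= k < N.+1) u k * \sum_(s <- confs n (N - k)) sweight u s * f (k :: s).
  by apply: eq_bigr => k _; rewrite /F; field; rewrite gt_eqF.
have e3 : \sum_(s <- confs n.+1 N) sweight u s =
   \sum_(0 <= k < N.+1) u k * seq_partition u n (N - k).
  by have := seq_partitionS u n => /(congr1 (fun F => F N)).
rewrite (e1 (fun k => ln (F k))) e2 e3 addrA; congr (_ - _).
by rewrite -big_split/=; apply: eq_bigr => k _; rewrite -mulrDr /F subrK.
Qed.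

Lemma wentropy_seq1 (T : Type) (x : T) (W f : T -> R) : W x != 0 -> wentropy [:: x] W f = 0.
Proof. 
move=> W0; rewrite /wentropy !big_seq1.
have -> : W x * f x / W x = f x by field.
ring.
Qed.

Lemma confs_0 n : confs n 0 = [:: nseq n 0%N].
Proof. by elim: n => //= n ->. Qed.

(** In the induction step [inner] collects the jumps that avoid the first site and
    [outer] those that involve it.  They bound the two terms of the chain rule:
    [inner] by the induction hypothesis; [outer] by the two-site inequality
    applied to the conditional mean [F], whose successive values are compared
    through the monotone coupling.  Bounding the coupling probabilities by one
    loses nothing of order [N]: the edge weight of the two-site inequality is
    that of the configuration with one particle removed, as in [outer]. *)
Theorem complete_graph_lsi (del a : R) n : 0 < del -> exists K : R, 0 <= K /\
  forall u c N (f : seq nat -> R), rated del a u c -> (forall s, 0 < f s) ->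
  wentropy (confs n.+1 N.+1) (sweight u) f <=
  K * complete_dirichlet u n.+1 N (fun s => Num.sqrt (f s)).
Proof.
move=> del0; elim: n => [|n [K [K0 IH]]].
  exists 0; split=> // u c N f H f0; rewrite mul0r.
  have e : confs 1 N.+1 = [:: [:: N.+1]].
    apply: perm_small_eq => //; apply: uniq_perm; rewrite ?uniq_confs// => s.
    rewrite mem_confs inE; case: s => [|k [|l s]] //=; last by rewrite eqseq_cons andbF.
    by rewrite addn0 eqseq_cons andbT.
  by rewrite e wentropy_seq1// gt_eqF// sweight_gt0//; exact: (rt_pos H).
have dn0 : 0 < del / 2 ^+ n by rewrite divr_gt0// exprn_gt0.
have [K' [K'0 HK']] := two_site_lsi a dn0.
exists (K + K'); split; first exact: addr_ge0.
move=> u c N f H f0; have u0 := rt_pos H.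
have [b Hv] := seq_partition_rated n del0 H; have v0 := rt_pos Hv.
set v := seq_partition u n.+1 in Hv v0.
have Hu : rated (del / 2 ^+ n) a u c.
  apply: rated_weaken H.
  by rewrite ler_pdivrMr ?exprn_gt0// ler_peMr ?(ltW del0)// exprn_ege1// ler1n.
have [q [q01 cpl]] := monotone_coupling n del0 H.
have W0 s : 0 < sweight u s by exact: sweight_gt0.
pose h s := Num.sqrt (f s).
rewrite wentropy_chain//; set F := (X in _ + wentropy _ _ X).
have F0 k : 0 < F k.
  rewrite divr_gt0//; apply: sum_gt0_seq => [|s _]; last exact: mulr_gt0.
  by have := v0 (N.+1 - k)%N; apply: contraTneq => e; rewrite /v /seq_partition e big_nil ltxx.
pose inner := \sum_(0 <= k < N.+1) u k * complete_dirichlet u n.+1 (N - k) (fun s => h (k :: s)).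
pose outer := \sum_(0 <= k < N.+1) u k * \sum_(s <- confs n.+1 (N - k))
  sweight u s * \sum_(0 <= j < n.+1) (h (k.+1 :: s) - h (k :: incr_nth s j)) ^+ 2.
have inner0 : 0 <= inner.
  apply: sumr_ge0 => k _; rewrite mulr_ge0 ?(ltW (u0 k))//; apply: sumr_ge0 => s _.
  rewrite mulr_ge0 ?(ltW (W0 s))//; apply: sumr_ge0 => i _.
  by apply: sumr_ge0 => j _; exact: sqr_ge0.
have outer0 : 0 <= outer.
  apply: sumr_ge0 => k _; rewrite mulr_ge0 ?(ltW (u0 k))//; apply: sumr_ge0 => s _.
  rewrite mulr_ge0 ?(ltW (W0 s))//; apply: sumr_ge0 => i _; exact: sqr_ge0.
have complete_dirichletE : inner + outer <= complete_dirichlet u n.+2 N h.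
  rewrite /complete_dirichlet sum_confsS /inner /outer -big_split/=.
  apply: ler_sum => k _; rewrite -mulrDr ler_pM2l// /complete_dirichlet -big_split/=.
  apply: ler_sum => s _; rewrite -mulrDr ler_pM2l//.
  rewrite [leRHS]big_nat_recl// addrC lerD//.
    by rewrite [leRHS]big_nat_recl//= subrr expr0n/= add0r.
  apply: ler_sum => i _; rewrite [leRHS]big_nat_recl//= lerDr; exact: sqr_ge0.
have b1 : \sum_(0 <= k < N.+2) u k *
    wentropy (confs n.+1 (N.+1 - k)) (sweight u) (fun s => f (k :: s)) <= K * inner.
  rewrite big_nat_recr//= subnn confs_0 wentropy_seq1 ?gt_eqF// mulr0 addr0.
  rewrite /inner big_distrr/=; apply: ler_sum_range => k /andP[_ kN].
  rewrite mulrCA ler_pM2l// subSn//.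
  exact: (IH u c (N - k)%N (fun s => f (k :: s))).
have b2 : wentropy (index_iota 0 N.+2) (fun k => u k * v (N.+1 - k)%N) F <= K' * outer.
  apply: le_trans (HK' u c v b N F Hu Hv F0) _; rewrite ler_wpM2l//.
  apply: ler_sum_range => k /andP[_ kN]; rewrite -mulrA ler_pM2l//.
  set M := (N - k)%N.
  have vM := v0 M.
  have Fk1 : F k.+1 = \sum_(s <- confs n.+1 M) sweight u s / v M * f (k.+1 :: s).
    rewrite /F subSS big_distrl/=; apply: eq_bigr => s _; ring.
  have Fk : F k = \sum_(s <- confs n.+1 M) sweight u s / v M *
      `|\sum_(0 <= j < n.+1) q M s j * f (k :: incr_nth s j)|.
    have := cpl M (fun s => f (k :: s)); rewrite -/v => e.
    rewrite /F (subSn (kN : (k <= N)%N)) -/M -/v.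
    apply: (mulfI (lt0r_neq0 vM)); apply: (mulfI (lt0r_neq0 (v0 M.+1))).
    transitivity (v M * \sum_(s <- confs n.+1 M.+1) sweight u s * f (k :: s)).
      by field; rewrite gt_eqF.
    rewrite e; congr (_ * _); rewrite big_distrr/=; apply: eq_big_seq => s sM.
    have [q0 _] := q01 _ _ sM.
    rewrite ger0_norm; first by field; rewrite gt_eqF.
    by apply: sumr_ge0 => j _; rewrite mulr_ge0 ?q0 ?(ltW (f0 _)).
  rewrite Fk1 Fk.
  have WM s : 0 <= sweight u s / v M by rewrite divr_ge0 ?(ltW (W0 s)) ?(ltW vM).
  rewrite -(ler_pM2l (_ : 0 < (v M)^-1)) ?invr_gt0// mulKf ?gt_eqF//.
  apply: le_trans (sqrt_mean_dist _ WM _ _) _ => [s|s|].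
  - exact: ltW.
  - exact: normr_ge0.
  rewrite big_distrr/= big_seq [leRHS]big_seq; apply: ler_sum => s sM.
  have [q0 q1] := q01 _ _ sM.
  rewrite [leRHS]mulrA [(v M)^-1 * _]mulrC ler_wpM2l//.
  have -> : f (k.+1 :: s) = \sum_(0 <= j < n.+1) q M s j * f (k.+1 :: s).
    by rewrite -big_distrl/= q1 mul1r.
  rewrite ger0_norm; last by apply: sumr_ge0 => j _; rewrite mulr_ge0 ?q0 ?(ltW (f0 _)).
  apply: le_trans (sqrt_mean_dist _ q0 _ _) _ => [j|j|]; rewrite ?(ltW (f0 _))//.
  apply: ler_sum_range => j jn; rewrite -[leRHS]mul1r ler_wpM2r ?sqr_ge0//.
  rewrite -q1 (bigD1_seq j) ?mem_index_iota ?iota_uniq//= lerDl.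
  by apply: sumr_ge0 => i _; exact: q0.
apply: le_trans (lerD b1 b2) _.
have : (K + K') * (inner + outer) <= (K + K') * complete_dirichlet u n.+2 N h.
  by rewrite ler_wpM2l// addr_ge0.
apply: le_trans; have := mulr_ge0 K0 outer0; have := mulr_ge0 K'0 inner0; lra.
Qed.

End ManySites.

(** * Smoothing the rates *)

Section Smoothing.
Context (R : realType).

Lemma rate_fact_gt0 (c : nat -> R) : (forall k, 0 < c k.+1) ->
  forall k, 0 < rate_fact c k.
Proof.
move=> c0 k; rewrite /rate_fact big_add1/=; apply: prodr_gt0 => i _; exact: c0.
Qed.

Lemma rate_factS (c : nat -> R) k : rate_fact c k.+1 = rate_fact c k * c k.+1.
Proof. by rewrite /rate_fact big_nat_recr. Qed.

Lemma ln_rate_fact (c : nat -> R) k : (forall k, 0 < c k.+1) ->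
  ln (rate_fact c k) = \sum_(0 <= i < k) ln (c i.+1).
Proof.
move=> c0; elim: k => [|k IH]; first by rewrite /rate_fact !big_geq// ln1.
by rewrite rate_factS lnM ?posrE ?rate_fact_gt0// IH big_nat_recr.
Qed.

Lemma rate_fact_rated del a (c : nat -> R) : 0 < del -> c 0%N = 0 ->
  (forall k, del <= c k.+1 - c k <= a) ->
  rated del a (fun k => (rate_fact c k)^-1) c.
Proof.
move=> del0 c0 inc.
have cp k : 0 < c k.+1.
  suff : 0 <= c k by have := inc k; lra.
  elim: k => [|k IH]; first by rewrite c0.
  by have := inc k; lra.
split=> // k; first by rewrite invr_gt0 rate_fact_gt0.
by rewrite rate_factS invfM mulrCA mulfV ?mulr1// gt_eqF.
Qed.

Section SlowlyVarying.
Context (l : nat -> R) (L : R).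
Context (lL : forall j, `|l j.+1 - l j| <= L).

Lemma slow_dist i t : `|l (i + t)%N - l i| <= t%:R * L.
Proof.
elim: t => [|t IH]; first by rewrite addn0 subrr normr0 mul0r.
rewrite addnS -natr1 mulrDl mul1r.
have -> : l (i + t).+1 - l i = (l (i + t)%N - l i) + (l (i + t).+1 - l (i + t)%N) by ring.
by apply: le_trans (ler_normD _ _) _; rewrite lerD.
Qed.

(** A second difference of the primitive of [l], whose own second differences are
    increments of [l]. *)
Lemma slow_second_diff y t :
  `|\sum_(0 <= s < y + t + t) l s + \sum_(0 <= s < y) l s
    - 2 * \sum_(0 <= s < y + t) l s| <= t%:R * (t%:R * L).
Proof.
rewrite (big_cat_nat (leq0n (y + t)) (leq_addr t _))/=.
have -> : \sum_(0 <= s < y + t) l s =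
  \sum_(0 <= s < y) l s + \sum_(y <= s < y + t) l s.
  by rewrite (big_cat_nat (leq0n y) (leq_addr t _)).
have sh p : \sum_(p <= s < p + t) l s = \sum_(0 <= i < t) l (i + p)%N.
  by rewrite -{1}[p]add0n big_addn addKn.
rewrite !sh.
set P := \sum_(0 <= s < y) l s.
have -> : P + \sum_(0 <= i < t) l (i + y)%N + \sum_(0 <= i < t) l (i + (y + t))%N +
   P - 2 * (P + \sum_(0 <= i < t) l (i + y)%N) =
   \sum_(0 <= i < t) (l (i + (y + t))%N - l (i + y)%N) by rewrite sumrB; ring.
apply: le_trans (ler_norm_sum _ _ _) _.
apply: (@le_trans _ _ (\sum_(0 <= i < t) (t%:R * L))).
  by apply: ler_sum => i _; rewrite addnA; exact: slow_dist.
by rewrite sumr_const_nat subn0 -[leLHS]mulr_natl.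
Qed.

(** Summing over [k] and pairing the positions [i] and [m.*2 - i] of the window,
    which is centred at [m], leaves a second difference of the primitive of [l] at
    each end of the range of summation. *)
Lemma centred_average m K :
  `|\sum_(0 <= k < K) ((m.*2.+1)%:R^-1 * (\sum_(0 <= i < m.*2.+1) l (k.+1 + i)%N)
      - l (k.+1 + m)%N)| <= m%:R * (m%:R * L).
Proof.
have L0 : 0 <= L by exact: le_trans (lL 0).
set n := m.*2.+1.
have n0 : 0 < n%:R :> R by rewrite ltr0n.
pose V x := \sum_(0 <= s < x) l s.
have VD i : \sum_(0 <= k < K) l (k.+1 + i)%N = V (K.+1 + i)%N - V i.+1.
  have h : (i.+1 <= K.+1 + i)%N by rewrite addSn ltnS leq_addl.
  rewrite /V (big_cat_nat (leq0n i.+1) h)/= [RHS]addrC addKr.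
  rewrite -{1}[i.+1]add0n big_addn addSnnS addnK.
  by apply: eq_bigr => k _; rewrite addSnnS.
pose P i := V (K.+1 + i)%N - V i.+1.
have -> : \sum_(0 <= k < K) (n%:R^-1 * (\sum_(0 <= i < n) l (k.+1 + i)%N) - l (k.+1 + m)%N)
  = n%:R^-1 * (\sum_(0 <= i < n) (P i - P m)).
  rewrite sumrB -big_distrr/= exchange_big/= VD -/(P m).
  under eq_bigr do rewrite VD -/(P _).
  rewrite [X in _ = _ * X](sumrB _ _ P (fun=> P m)) sumr_const_nat subn0 mulrBr.
  by rewrite -[P m *+ n]mulr_natl mulKf ?gt_eqF.
rewrite normrM gtr0_norm ?invr_gt0// mulrC ler_pdivrMr//.
have -> : \sum_(0 <= i < n) (P i - P m) =
  2^-1 * \sum_(0 <= i < n) (P i + P (m.*2 - i)%N - 2 * P m).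
  have e : \sum_(0 <= i < n) (P (m.*2 - i)%N - P m) = \sum_(0 <= i < n) (P i - P m).
    rewrite [RHS]big_nat_rev/=; apply: eq_bigr => i _.
    by rewrite add0n /n subSS.
  have : \sum_(0 <= i < n) (P i + P (m.*2 - i)%N - 2 * P m) =
    \sum_(0 <= i < n) (P i - P m) + \sum_(0 <= i < n) (P (m.*2 - i)%N - P m).
    by rewrite -big_split/=; apply: eq_bigr => i _; ring.
  by rewrite e => ->; field.
have bnd x i : (i <= m)%N ->
    `|V (x + i)%N + V (x + (m.*2 - i))%N - 2 * V (x + m)%N| <= m%:R * (m%:R * L).
  move=> im; have := slow_second_diff (x + i) (m - i).
  have -> : (x + i + (m - i))%N = (x + m)%N by lia.
  have -> : (x + m + (m - i))%N = (x + (m.*2 - i))%N by lia.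
  rewrite -/(V _) -/(V _) -/(V _) [V (x + (m.*2 - i))%N + _]addrC => /le_trans; apply.
  have h : (m - i)%:R <= m%:R :> R by rewrite ler_nat leq_subr.
  by apply: ler_pM => //; [rewrite mulr_ge0|rewrite ler_wpM2r].
have bnd' x i : (i < n)%N ->
    `|V (x + i)%N + V (x + (m.*2 - i))%N - 2 * V (x + m)%N| <= m%:R * (m%:R * L).
  rewrite ltnS => iM; have [im|mi] := leqP i m; first exact: bnd.
  have := bnd x (m.*2 - i)%N; rewrite subKn// [V (x + i)%N + _]addrC; apply; lia.
rewrite normrM ger0_norm ?invr_ge0//.
have : `|\sum_(0 <= i < n) (P i + P (m.*2 - i)%N - 2 * P m)| <=
   \sum_(0 <= i < n) (2 * (m%:R * (m%:R * L))).
  apply: le_trans (ler_norm_sum _ _ _) _; apply: ler_sum_range => i /andP[_ iN].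
  have h1 := bnd' K.+1 i iN; have h2 := bnd' 1%N i iN.
  have -> : P i + P (m.*2 - i)%N - 2 * P m =
    (V (K.+1 + i)%N + V (K.+1 + (m.*2 - i))%N - 2 * V (K.+1 + m)%N) -
    (V (1 + i)%N + V (1 + (m.*2 - i))%N - 2 * V (1 + m)%N).
    by rewrite /P !add1n; ring.
  by apply: le_trans (ler_normB _ _) _; lra.
rewrite sumr_const_nat subn0 -[_ *+ n]mulr_natl; lra.
Qed.

End SlowlyVarying.

(** The smoothed rate [c'] is the geometric mean of [c] over the window of length
    [2 m + 1] centred at [k].  The ratio of its successive values only involves the
    two ends of a window, [2 m + 1] apart, to which (M) applies; and the sum of
    [ln c' - ln c] stays bounded by [centred_average], so that the weights are
    comparable. *)
Lemma rate_smoothing (cinf a1 a2 : R) (m : nat) : 0 < cinf -> 0 < a2 -> (0 < m)%N ->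
  exists del a A : R, [/\ 0 < del, 0 < A &
  forall c : nat -> R, c 0%N = 0 -> (forall k, cinf <= c k.+1) ->
    (forall k, `|c k.+1 - c k| <= a1) ->
    (forall j k, (j + m <= k)%N -> a2 <= c k - c j) ->
  exists u c', rated del a u c' /\ forall k,
    u k <= A * (rate_fact c k)^-1 /\ (rate_fact c k)^-1 <= A * u k].
Proof.
move=> cinf0 a20 m0.
pose n := m.*2.+1; have n0 : 0 < n%:R :> R by rewrite ltr0n.
have n1 : 1 <= n%:R :> R by rewrite ler1n.
pose L := ln (1 + 2 * `|a1| / cinf).
have A0 : 1 <= 1 + 2 * `|a1| / cinf.
  by rewrite lerDl divr_ge0 ?(ltW cinf0)// mulr_ge0.
have L0 : 0 <= L by exact: ln_ge0.
pose E := expR (n%:R * L).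
have E0 : 0 < E by exact: expR_gt0.
have E1 : E * E^-1 = 1 by rewrite mulfV// gt_eqF.
have Ei0 : 0 < E^-1 by rewrite invr_gt0.
pose a2' := Num.min a2 (cinf / 2).
have a2'0 : 0 < a2' by rewrite lt_min a20 divr_gt0.
pose del1 := E^-1 * (cinf / 2); pose del2 := a2' / (n%:R * E ^+ 2).
have d10 : 0 < del1 by rewrite mulr_gt0// divr_gt0.
have d20 : 0 < del2 by rewrite divr_gt0// mulr_gt0// exprn_gt0.
exists (Num.min del1 del2), (Num.max (E * (cinf / 2)) (E * (n%:R * a1))),
  (expR (m%:R * (m%:R * L))).
split; [by rewrite lt_min d10|exact: expR_gt0|].
move=> c c0 cge cLG cM.
have cp k : 0 < c k.+1 by exact: lt_le_trans (cge k).
have a1c : cinf <= a1.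
  by have := cLG 0%N; rewrite c0 subr0 gtr0_norm//; exact: le_trans.
have a1n : `|a1| = a1 by rewrite gtr0_norm//; lra.
(* the rate is shifted by [m] and extended to the left by a constant smaller
   than all its values, so that the windows near the origin make sense *)
pose c1 j := if (j <= m)%N then cinf / 2 else c (j - m)%N.
have c1R j : (m < j)%N -> c1 j = c (j - m)%N by move=> mj; rewrite /c1 leqNgt mj.
have c1S j : (m < j)%N -> cinf <= c1 j.
  move=> mj; rewrite c1R// -(subnSK mj); exact: cge.
have c1ge j : cinf / 2 <= c1 j.
  have [jm|/c1S] := leqP j m; [by rewrite /c1 jm|lra].
have c1p j : 0 < c1 j by apply: lt_le_trans (c1ge j); rewrite divr_gt0.
have c1d j : `|c1 j.+1 - c1 j| <= a1.
  have [jm|mj] := leqP j m.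
    have [j1m|j1m] := leqP j.+1 m.
      by rewrite /c1 jm j1m subrr normr0; lra.
    have jE : j = m by apply/eqP; rewrite eqn_leq jm -ltnS j1m.
    rewrite /c1 jm leqNgt j1m/= jE subSn// subnn.
    have := cge 0%N; have := cLG 0%N; rewrite c0 subr0 gtr0_norm// => h1 h2.
    rewrite ger0_norm; lra.
  have mj1 : (m < j.+1)%N by exact: ltnW.
  by rewrite !c1R// (subSn (ltnW mj)).
have c1r j : c1 j.+1 <= (1 + 2 * `|a1| / cinf) * c1 j /\
    c1 j <= (1 + 2 * `|a1| / cinf) * c1 j.+1.
  have key x y : cinf / 2 <= x -> `|y - x| <= a1 -> y <= (1 + 2 * `|a1| / cinf) * x.
    move=> hx /ler_normlP[_ hy]; rewrite a1n.
    have : a1 <= 2 * a1 / cinf * x.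
      have -> : 2 * a1 / cinf * x = 2 * a1 * x / cinf by ring.
      rewrite ler_pdivlMr//.
      have : a1 * (cinf / 2) <= a1 * x by rewrite ler_wpM2l//; lra.
      lra.
    lra.
  by split; apply: key => //; rewrite distrC.
pose l j := ln (c1 j).
have lL j : `|l j.+1 - l j| <= L.
  have [h1 h2] := c1r j.
  have A00 : 0 < 1 + 2 * `|a1| / cinf by lra.
  rewrite ler_norml; apply/andP; split.
    have : l j <= ln ((1 + 2 * `|a1| / cinf) * c1 j.+1).
      by rewrite ler_ln ?posrE ?mulr_gt0.
    by rewrite lnM ?posrE// -/L -/(l _); lra.
  have : l j.+1 <= ln ((1 + 2 * `|a1| / cinf) * c1 j).
    by rewrite ler_ln ?posrE ?mulr_gt0.
  by rewrite lnM ?posrE// -/L -/(l _); lra.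
pose avg k := n%:R^-1 * (\sum_(0 <= i < n) l (k + i)%N).
pose c' k := if k is 0 then 0 else expR (avg k).
have avg_l k : `|avg k - l k| <= n%:R * L.
  have -> : avg k - l k = n%:R^-1 * \sum_(0 <= i < n) (l (k + i)%N - l k).
    rewrite sumrB sumr_const_nat subn0 mulrBr -[l k *+ n]mulr_natl.
    by rewrite mulKf ?gt_eqF.
  rewrite normrM gtr0_norm ?invr_gt0// mulrC ler_pdivrMr//.
  apply: le_trans (ler_norm_sum _ _ _) _.
  apply: (@le_trans _ _ (\sum_(0 <= i < n) (n%:R * L))).
    apply: ler_sum_range => i /andP[_ iN].
    apply: le_trans (slow_dist lL _ _) _.
    by rewrite ler_wpM2r// ler_nat ltnW.
  by rewrite sumr_const_nat subn0 -[leLHS]mulr_natl mulrC.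
have expl k : expR (l k) = c1 k by rewrite lnK ?posrE.
have c'_bd k : E^-1 * c1 k.+1 <= c' k.+1 <= E * c1 k.+1.
  have := avg_l k.+1; rewrite ler_norml => /andP[h1 h2].
  rewrite /= -(expl k.+1) /E -expRN -!expRD !ler_expR; lra.
have inc k : Num.min del1 del2 <= c' k.+1 - c' k <=
    Num.max (E * (cinf / 2)) (E * (n%:R * a1)).
  case: k => [|k].
    rewrite [c' 0%N]/= subr0 ge_min le_max.
    have := c'_bd 0%N; rewrite {1 2}/c1 m0 => /andP[h1 h2].
    by rewrite /del1 h1 h2.
  have avgS : avg k.+2 = avg k.+1 + n%:R^-1 * (l (k.+1 + n)%N - l k.+1).
    rewrite /avg [in LHS](_ : \sum_(0 <= i < n) l (k.+2 + i)%N =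
      \sum_(0 <= i < n) l (k.+1 + i)%N + (l (k.+1 + n)%N - l k.+1)); last first.
      have h1 : \sum_(0 <= i < n.+1) l (k.+1 + i)%N =
        \sum_(0 <= i < n) l (k.+1 + i)%N + l (k.+1 + n)%N by rewrite big_nat_recr.
      have h2 : \sum_(0 <= i < n.+1) l (k.+1 + i)%N =
        l k.+1 + \sum_(0 <= i < n) l (k.+2 + i)%N.
        rewrite big_nat_recl// addn0; congr (_ + _).
        by apply: eq_bigr => i _; rewrite addnS.
      by move: h2; rewrite h1 => h2; lra.
    by ring.
  set x := l (k.+1 + n)%N - l k.+1 in avgS.
  have c'S : c' k.+2 - c' k.+1 = c' k.+1 * (expR (n%:R^-1 * x) - 1).
    by rewrite /= avgS expRD; ring.
  have c1n : a2' <= c1 (k.+1 + n)%N - c1 k.+1.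
    have mkn : (m < k.+1 + n)%N by rewrite /n addnS ltnS -addnn addnA leq_addl.
    rewrite ge_min; apply/orP; have [km|mk] := leqP k.+1 m.
      right; rewrite [c1 k.+1]/c1 km; have := c1S _ mkn; lra.
    left; rewrite !c1R//; apply: cM; rewrite /n; lia.
  have xE : expR x = c1 (k.+1 + n)%N / c1 k.+1 by rewrite expRB !expl.
  have x_ge : a2' / c1 (k.+1 + n)%N <= x.
    have := ln_leB1 (divr_gt0 (c1p k.+1) (c1p (k.+1 + n)%N)).
    rewrite ln_div ?posrE// -!/(l _) => h.
    have : a2' / c1 (k.+1 + n)%N <= 1 - c1 k.+1 / c1 (k.+1 + n)%N.
      rewrite ler_pdivrMr// mulrBl mul1r divfK ?gt_eqF//.
    by rewrite /x; lra.
  have x0 : 0 <= x by apply: le_trans x_ge; rewrite divr_ge0 ?(ltW a2'0) ?(ltW (c1p _)).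
  have c1E : c1 (k.+1 + n)%N <= E * c1 k.+1.
    have := slow_dist lL k.+1 n; rewrite ler_norml => /andP[_ h].
    by rewrite -!expl /E -expRD ler_expR; lra.
  have /andP[b1 b2] := c'_bd k.
  have c'p : 0 < c' k.+1 by exact: expR_gt0.
  apply/andP; split.
    rewrite ge_min; apply/orP; right; rewrite c'S.
    have e1 : n%:R^-1 * x <= expR (n%:R^-1 * x) - 1.
      by have := expR_ge1Dx (n%:R^-1 * x); lra.
    apply: (@le_trans _ _ (c' k.+1 * (n%:R^-1 * x))); last by rewrite ler_pM2l.
    apply: (@le_trans _ _ (E^-1 * c1 k.+1 * (n%:R^-1 * (a2' / (E * c1 k.+1))))).
      rewrite le_eqVlt; apply/orP; left; apply/eqP.
      by rewrite /del2; field; rewrite !gt_eqF.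
    apply: ler_pM => //.
    - by rewrite mulr_ge0 ?(ltW Ei0) ?(ltW (c1p _)).
    - rewrite mulr_ge0 ?invr_ge0 ?(ltW n0)// divr_ge0 ?(ltW a2'0)//.
      by rewrite mulr_ge0 ?(ltW E0) ?(ltW (c1p _)).
    rewrite ler_pM2l ?invr_gt0//; apply: le_trans x_ge.
    by rewrite ler_pM2l// lef_pV2 ?posrE ?mulr_gt0.
  rewrite le_max; apply/orP; right; rewrite c'S.
  have e1 : expR (n%:R^-1 * x) <= expR x.
    by rewrite ler_expR -[leRHS]mul1r ler_wpM2r// invf_le1.
  apply: (@le_trans _ _ (E * c1 k.+1 * (c1 (k.+1 + n)%N / c1 k.+1 - 1))).
    apply: ler_pM => //; first exact: ltW.
      have := expR_ge1Dx (n%:R^-1 * x).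
      have : 0 <= n%:R^-1 * x by rewrite mulr_ge0 ?invr_ge0 ?(ltW n0).
      lra.
    by rewrite -xE; lra.
  have -> : E * c1 k.+1 * (c1 (k.+1 + n)%N / c1 k.+1 - 1) =
    E * (c1 (k.+1 + n)%N - c1 k.+1) by field; rewrite gt_eqF.
  rewrite ler_pM2l//; apply: le_trans (ler_norm _) _; exact: slow_dist c1d _ _.
have del0 : 0 < Num.min del1 del2 by rewrite lt_min d10.
exists (fun k => (rate_fact c' k)^-1), c'; split; first exact: rate_fact_rated.
move=> k.
have c'p j : 0 < c' j.+1 by exact: expR_gt0.
have r1 := rate_fact_gt0 cp k; have r2 := rate_fact_gt0 c'p k.
have := centred_average lL m k.
have -> : \sum_(0 <= k < k) ((m.*2.+1)%:R^-1 *
     (\sum_(0 <= i < m.*2.+1) l (k.+1 + i)%N) - l (k.+1 + m)%N) =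
   ln (rate_fact c' k) - ln (rate_fact c k).
  rewrite !ln_rate_fact// -sumrB; apply: eq_bigr => j _.
  rewrite /= expRK; congr (_ - _).
  by rewrite /l /c1 leqNgt addSn ltnS leq_addl/= -addSn addnK.
rewrite ler_norml => /andP[h1 h2].
have e x y : 0 < x -> 0 < y -> ln y - ln x <= m%:R * (m%:R * L) ->
    x^-1 <= expR (m%:R * (m%:R * L)) * y^-1.
  move=> x0 y0 h; rewrite ler_pdivlMr// mulrC ler_pdivrMr//.
  by rewrite -[leLHS]lnK ?posrE// -[in leRHS](lnK (_ : x \is Num.pos)) ?posrE//
    -expRD ler_expR; lra.
by split; apply: e => //; lra.
Qed.

End Smoothing.

(** * From configurations to sequences of occupation numbers *)

Section Transfer.
Context (R : realType) (d : nat) (Lam : {fset 'rV[int]_d}).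
Implicit Types (x y : Lam) (eta : config Lam) (s : seq nat).

Local Notation n := #|{: Lam}|.

(** Inverse to [codom], which lists the occupation numbers of a configuration. *)
Definition config_of s : config Lam := [ffun x => nth 0%N s (enum_rank x)].

Lemma codom_config_of s : size s = n -> codom (config_of s) = s.
Proof.
move=> sn; apply: (@eq_from_nth _ 0%N); first by rewrite size_codom sn.
move=> i; rewrite size_codom => iN.
by rewrite (nth_codom _ _ (Ordinal iN)) ffunE enum_valK.
Qed.

Lemma config_of_codom eta : config_of (codom eta) = eta.
Proof. by apply/ffunP => x; rewrite ffunE nth_codom enum_rankK. Qed.

Lemma particles_codom eta : particles eta = sumn (codom eta).
Proof. by rewrite sumnE big_map big_enum. Qed.

Lemma weight_codom (c : nat -> R) eta :
  weight c eta = sweight (fun k => (rate_fact c k)^-1) (codom eta).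
Proof. by rewrite /weight /sweight big_map big_enum. Qed.

Lemma sum_configs N (F : config Lam -> R) :
  \sum_(eta \in configs_with N) F eta = \sum_(s <- confs n N) F (config_of s).
Proof.
have fin := @finite_configs_with d Lam N.
rewrite fsbig_finite//= -(big_map config_of xpredT F); apply: perm_big.
have sz s : s \in confs n N -> size s = n by rewrite mem_confs => /andP[/eqP].
apply: uniq_perm; first exact: fset_uniq.
  rewrite map_inj_in_uniq ?uniq_confs// => s t /sz sn /sz tn e.
  by rewrite -(codom_config_of sn) e codom_config_of.
move=> eta; rewrite in_fset_set//; apply/idP/mapP => [|[s sN ->]].
  rewrite inE /configs_with/= => pN; exists (codom eta); last by rewrite config_of_codom.
  by rewrite mem_confs size_codom eqxx -particles_codom pN/=.
rewrite inE /configs_with/= particles_codom codom_config_of ?sz//.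
by move: sN; rewrite mem_confs => /andP[_ /eqP].
Qed.

(** The dictionary between the canonical measure and sums over [confs]. *)
Lemma canonical_meanE (c : nat -> R) N (F : config Lam -> R) :
  canonical_mean c N F =
  (seq_partition (fun k => (rate_fact c k)^-1) n N)^-1 *
  \sum_(s <- confs n N) sweight (fun k => (rate_fact c k)^-1) s * F (config_of s).
Proof.
have wE s : s \in confs n N ->
    weight c (config_of s) = sweight (fun k => (rate_fact c k)^-1) s.
  by rewrite mem_confs => /andP[/eqP sn _]; rewrite weight_codom codom_config_of.
rewrite /canonical_mean sum_configs /canonical_pmf.
have -> : partition_function Lam c N = seq_partition (fun k => (rate_fact c k)^-1) n N.
  rewrite /partition_function sum_configs; exact: eq_big_seq.
rewrite big_distrr/=; apply: eq_big_seq => s sN.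
by rewrite wE// mulrA.
Qed.

Lemma entropyE (c : nat -> R) N (f : config Lam -> R) :
  entropy (canonical_mean c N) f =
  (seq_partition (fun k => (rate_fact c k)^-1) n N)^-1 *
  wentropy (confs n N) (sweight (fun k => (rate_fact c k)^-1)) (fun s => f (config_of s)).
Proof.
rewrite /entropy !canonical_meanE /wentropy -/(seq_partition _ n N).
set Z := seq_partition _ n N; set S := \sum_(s <- _) sweight _ s * f _.
by rewrite [S / Z]mulrC; ring.
Qed.

Lemma move_config_of x y s : size s = n ->
  move x y (config_of (incr_nth s (enum_rank x))) =
  config_of (incr_nth s (enum_rank y)).
Proof.
move=> sn; apply/ffunP => z; rewrite !ffunE !nth_incr_nth.
rewrite ![_ == nat_of_ord (enum_rank z)]eq_sym !(inj_eq val_inj).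
by rewrite !(inj_eq (can_inj (@enum_rankK Lam))) addKn addnC.
Qed.

(** Removing the particle about to jump absorbs the jump rate. *)
Lemma sum_confs_rate (u c : nat -> R) k N i (G : seq nat -> R) :
  c 0%N = 0 -> (forall j, u j = c j.+1 * u j.+1) -> (i < k)%N ->
  \sum_(s <- confs k N.+1) sweight u s * (c (nth 0%N s i) * G s) =
  \sum_(s <- confs k N) sweight u s * G (incr_nth s i).
Proof.
move=> c0 rev; elim: k N i G => [//|k IH] N [|i] G ik.
  rewrite !sum_confsS big_nat_recl//= [X in _ * X + _]big1 ?mulr0 ?add0r; last first.
    by move=> s _; rewrite c0 mul0r mulr0.
  apply: eq_bigr => j _; rewrite subSS (rev j) -mulrA mulrCA.
  congr (_ * _); rewrite !big_distrr/=; apply: eq_bigr => s _; ring.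
rewrite !sum_confsS big_nat_recr//= subnn confs_0 big_seq1 nth_nseq if_same c0.
rewrite mul0r !mulr0 addr0; apply: eq_big_nat => j /andP[_ jN].
by rewrite (subSn (jN : (j <= N)%N)) (IH _ _ (fun s => G (j :: s))).
Qed.

Lemma dirichletE (c : nat -> R) N (g : config Lam -> R) :
  c 0%N = 0 -> (forall k, 0 < c k.+1) ->
  dirichlet c N.+1 g g = (seq_partition (fun k => (rate_fact c k)^-1) n N.+1)^-1 *
    (2^-1 * \sum_(s <- confs n N) sweight (fun k => (rate_fact c k)^-1) s *
     \sum_(x : Lam) \sum_(y : Lam | dist1 (val x) (val y) == 1)
       (g (config_of (incr_nth s (enum_rank x))) -
        g (config_of (incr_nth s (enum_rank y)))) ^+ 2).
Proof.
move=> c0 cp; rewrite /dirichlet mulrCA; congr (_ * _).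
set u := fun k => (rate_fact c k)^-1.
have rev j : u j = c j.+1 * u j.+1.
  by rewrite /u rate_factS invfM mulrCA mulfV ?mulr1// gt_eqF.
under [X in _ = _ * X]eq_bigr do rewrite big_distrr/=.
rewrite exchange_big/= big_distrr/=; apply: eq_bigr => x _.
under [X in _ = _ * X]eq_bigr do rewrite big_distrr/=.
rewrite exchange_big/= big_distrr/=; apply: eq_bigr => y _.
rewrite canonical_meanE; congr (_ * _).
have ix : (enum_rank x < n)%N by exact: ltn_ord.
pose G s := (g (move x y (config_of s)) - g (config_of s)) ^+ 2.
transitivity (\sum_(s <- confs n N.+1) sweight u s *
    (c (nth 0%N s (enum_rank x)) * G s)).
  by apply: eq_bigr => s _; rewrite /grad /G ffunE; ring.
rewrite (sum_confs_rate N G c0 rev ix); apply: eq_big_seq => s.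
rewrite mem_confs => /andP[/eqP sn _].
by rewrite /G move_config_of// -sqrrN opprB.
Qed.

End Transfer.

(** * The cube *)

Lemma dist1_ge0 d (x y : 'rV[int]_d) : 0 <= dist1 x y.
Proof. exact: sumr_ge0. Qed.

(** The first step of a shortest path inside the cube. *)
Lemma cube_step d L (x y : cube d L) : x != y -> exists z : cube d L,
  dist1 (val x) (val z) = 1 /\ dist1 (val z) (val y) = dist1 (val x) (val y) - 1.
Proof.
move=> xy.
have [i xyi] : exists i, val x 0 i != val y 0 i.
  apply/existsP; rewrite -negb_forall; apply: contra xy => /forallP e.
  by apply/eqP/val_inj/rowP => i; apply/eqP.
pose t : int := if val x 0 i < val y 0 i then val x 0 i + 1 else val x 0 i - 1.
pose z : 'rV[int]_d := \row_j if j == i then t else val x 0 j.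
have xin : forall i, 0 <= val x 0 i <= L%:Z.
  by apply/forallP; rewrite -in_cube; exact: valP.
have yin : forall i, 0 <= val y 0 i <= L%:Z.
  by apply/forallP; rewrite -in_cube; exact: valP.
have zin : z \in cube d L.
  rewrite in_cube; apply/forallP => j; rewrite mxE; case: eqP => [_|_]; last exact: xin.
  have := xin i; have := yin i; rewrite /t; move: xyi.
  by case: ltP; move: (val x 0 i) (val y 0 i) => p q; lia.
exists [` zin]%fset; split; rewrite /dist1 (bigD1 i)//=.
  rewrite big1 ?addr0; last first.
    by move=> j /negPf ji; rewrite mxE ji subrr.
  by rewrite mxE eqxx /t; case: ifP => _; move: (val x 0 i) => p; lia.
rewrite [in RHS](bigD1 i)//= mxE eqxx.
have -> : \sum_(j < d | j != i) `|z 0 j - val y 0 j| =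
   \sum_(j < d | j != i) `|val x 0 j - val y 0 j|.
  by apply: eq_bigr => j /negPf ji; rewrite mxE ji.
set S := \sum_(j < d | _) _.
suff : `|t - val y 0 i| = `|val x 0 i - val y 0 i| - 1 by move=> ->; ring.
by move: xyi; rewrite /t; case: ltP; move: (val x 0 i) (val y 0 i) => p q; lia.
Qed.

(** Telescoping along a shortest path, each edge of which contributes at most the
    square root of the sum on the right. *)
Lemma cube_path_bound (R : realType) d L (a : cube d L -> R) (x y : cube d L) :
  (a x - a y) ^+ 2 <= (`|dist1 (val x) (val y)|%N%:R) ^+ 2 *
   \sum_(x : cube d L) \sum_(y : cube d L | dist1 (val x) (val y) == 1)
      (a x - a y) ^+ 2.
Proof.
set Q := \sum_(x : cube d L) _.
have Q0 : 0 <= Q by apply: sumr_ge0 => u _; apply: sumr_ge0 => v _; exact: sqr_ge0.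
have adj u v : dist1 (val u) (val v) = 1 -> `|a u - a v| <= Num.sqrt Q.
  move=> uv; rewrite -sqrtr_sqr ler_wsqrtr// /Q (bigD1 u)//= (bigD1 v)/= ?uv//.
  rewrite -addrA lerDl addr_ge0//; first by apply: sumr_ge0 => w _; exact: sqr_ge0.
  by apply: sumr_ge0 => w _; apply: sumr_ge0 => w' _; exact: sqr_ge0.
suff H m : forall x, `|dist1 (val x) (val y)|%N = m ->
    `|a x - a y| <= m%:R * Num.sqrt Q.
  rewrite -[Q in leRHS](sqr_sqrtr Q0) -exprMn -real_normK ?num_real// ler_sqr ?nnegrE//.
    exact: H.
  by rewrite mulr_ge0 ?sqrtr_ge0.
elim: m => [|m IH] {}x xym.
  have [->|/cube_step[z [h1 h2]]] := eqVneq x y.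
    by rewrite subrr normr0 mul0r.
  have := dist1_ge0 (val z) (val y); rewrite h2; move: xym.
  move: (dist1 _ _) => q; lia.
have [->|/cube_step[z [h1 h2]]] := eqVneq x y.
  by rewrite subrr normr0 mulr_ge0 ?sqrtr_ge0.
have zm : `|dist1 (val z) (val y)|%N = m.
  have := dist1_ge0 (val z) (val y); rewrite h2; move: xym.
  move: (dist1 _ _) => q; lia.
have -> : a x - a y = (a x - a z) + (a z - a y) by ring.
apply: le_trans (ler_normD _ _) _.
by have := adj _ _ h1; have := IH z zm; rewrite -natr1; lra.
Qed.

Lemma sweight_perturb (R : realType) (u v : nat -> R) A s : 0 <= A ->
  (forall k, 0 < u k) -> (forall k, u k <= A * v k) ->
  sweight u s <= A ^+ size s * sweight v s.
Proof.
move=> A0 u0 uv; rewrite /sweight; elim: s => [|k s IH].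
  by rewrite !big_nil expr0 mulr1.
rewrite !big_cons/= exprS mulrACA ler_pM// ?(ltW (u0 k))//.
by apply/ltW/prodr_gt0.
Qed.

Theorem theorem2p1 (R : realType) (d : nat) (a1 a2 cinf : R) (k0 : nat) :
  (1 <= d)%N -> 0 < a2 -> (0 < k0)%N -> 0 < cinf ->
  exists C : nat -> R,
    (forall L : nat, 0 < C L) /\
    forall c : nat -> R,
      (forall n : nat, 0 <= c n) ->
      c 0%N = 0 ->
      inf [set c n | n in [set n : nat | (0 < n)%N]] = cinf ->
      has_ubound [set `|c k.+1 - c k| | k in [set: nat]] ->
      sup [set `|c k.+1 - c k| | k in [set: nat]] = a1 ->
      (forall j k : nat, (j + k0 <= k)%N -> a2 <= c k - c j) ->
      forall (N L : nat) (f : config (cube d L) -> R),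
        (1 <= N)%N -> (2 <= L)%N -> (forall eta, 0 < f eta) ->
        entropy (canonical_mean c N) f <=
          C L * dirichlet c N (fun eta => Num.sqrt (f eta))
                              (fun eta => Num.sqrt (f eta)).
Proof.
move=> _ a20 k00 cinf0.
have [del [a [A [del0 A0 smooth]]]] := rate_smoothing a1 cinf0 a20 k00.
have lsi n : {K : R | 0 <= K /\ forall u c N (f : seq nat -> R),
    rated del a u c -> (forall s, 0 < f s) ->
    wentropy (confs n.+1 N.+1) (sweight u) f <=
    K * complete_dirichlet u n.+1 N (fun s => Num.sqrt (f s))}.
  exact/cid/complete_graph_lsi.
pose nsites L := #|{: cube d L}|.
pose Dist L : R := \sum_(x : cube d L) \sum_(y : cube d L)
  (`|dist1 (val x) (val y)|%N%:R) ^+ 2.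
pose C0 L := 2 * (A ^+ nsites L * (sval (lsi (nsites L).-1) *
  (A ^+ nsites L * Dist L))).
have Dist0 L : 0 <= Dist L.
  by apply: sumr_ge0 => x _; apply: sumr_ge0 => y _; exact: sqr_ge0.
have An0 L : 0 <= A ^+ nsites L by rewrite exprn_ge0// ltW.
have C00 L : 0 <= C0 L.
  have [K0 _] := svalP (lsi (nsites L).-1).
  by apply: mulr_ge0 => //; apply: mulr_ge0 => //; apply: mulr_ge0 => //; exact: mulr_ge0.
exists (fun L => C0 L + 1); split=> [L|c c_ge0 c0 cinfE cub supE cM N L f N1 L2 f0].
  by apply: ltr_wpDl.
have cge k : cinf <= c k.+1.
  rewrite -cinfE; apply: ge_inf; last by exists k.+1.
  by exists 0 => _ [n _ <-].
have cLG k : `|c k.+1 - c k| <= a1.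
  by rewrite -supE; apply: ub_le_sup => //; exists k.
have [u' [c' [Hu' uu']]] := smooth c c0 cge cLG cM.
have cp k : 0 < c k.+1 by exact: lt_le_trans (cge k).
case: N N1 => // N _.
set u := fun k => (rate_fact c k)^-1.
have u0 k : 0 < u k by rewrite invr_gt0 rate_fact_gt0.
have u'0 := rt_pos Hu'.
set n := nsites L.
have nE : n = n.-1.+1.
  rewrite prednK// /n /nsites -/(#|_|).
  have z0 : (\row_(i < d) 0 : 'rV[int]_d) \in cube d L.
    by rewrite in_cube; apply/forallP => i; rewrite mxE.
  by apply/card_gt0P; exists [` z0]%fset.
have [K0 HK] := svalP (lsi n.-1).
set K := sval (lsi n.-1) in K0 HK.
rewrite entropyE dirichletE// -/u.
set Z := seq_partition u _ _.
have Zi0 : 0 <= Z^-1.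
  by rewrite invr_ge0; apply: sumr_ge0 => s _; exact/ltW/sweight_gt0.
rewrite [leRHS]mulrCA ler_wpM2l//.
pose F s := f (@config_of d (cube d L) s).
pose h s := Num.sqrt (F s).
pose Q s := \sum_(x : cube d L) \sum_(y : cube d L | dist1 (val x) (val y) == 1)
  (h (incr_nth s (enum_rank x)) - h (incr_nth s (enum_rank y))) ^+ 2.
have Q0 s : 0 <= Q s.
  by apply: sumr_ge0 => x _; apply: sumr_ge0 => y _; exact: sqr_ge0.
have b1 : wentropy (confs n N.+1) (sweight u) F <= A ^+ n * wentropy (confs n N.+1) (sweight u') F.
  apply: wentropy_perturb => [s|s _|s]; [|exact: sweight_gt0|exact: f0].
  rewrite mem_confs => /andP[/eqP <- _]; rewrite sweight_gt0//=.
  by apply: sweight_perturb => //; [exact: ltW|move=> k; have [_] := uu' k].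
have b2 : wentropy (confs n N.+1) (sweight u') F <= K * complete_dirichlet u' n N h.
  by rewrite [in leLHS]nE [in leRHS]nE; apply: (HK u' c' N F) => // s; exact: f0.
have b3 : complete_dirichlet u' n N h <= A ^+ n * (Dist L * \sum_(s <- confs n N) sweight u s * Q s).
  rewrite /complete_dirichlet !big_distrr/= big_seq [leRHS]big_seq; apply: ler_sum => s.
  rewrite mem_confs => /andP[/eqP sn _].
  have -> : A ^+ n * (Dist L * (sweight u s * Q s)) =
    (A ^+ n * sweight u s) * (Dist L * Q s) by rewrite [RHS]mulrACA mulrA.
  apply: ler_pM.
  - exact/ltW/sweight_gt0.
  - by apply: sumr_ge0 => i _; apply: sumr_ge0 => j _; exact: sqr_ge0.
  - rewrite -sn; apply: sweight_perturb => //; first exact: ltW.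
    by move=> k; have [] := uu' k.
  rewrite big_mkord (reindex (@enum_rank (cube d L)))/=; last exact/onW_bij/enum_rank_bij.
  rewrite /Dist big_distrl/=; apply: ler_sum => x _.
  rewrite big_mkord (reindex (@enum_rank (cube d L)))/=; last exact/onW_bij/enum_rank_bij.
  rewrite big_distrl/=; apply: ler_sum => y _.
  exact: (cube_path_bound (fun x => h (incr_nth s (enum_rank x)))).
set S := \sum_(s <- confs n N) sweight u s * Q s in b3.
have S0 : 0 <= S.
  by apply: sumr_ge0 => s _; rewrite mulr_ge0// ltW// sweight_gt0.
change (wentropy (confs n N.+1) (sweight u) F <= (C0 L + 1) * (2^-1 * S)).
apply: le_trans b1 _; apply: le_trans (ler_wpM2l (An0 L) b2) _.
have := ler_wpM2l (An0 L) (ler_wpM2l K0 b3).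
move=> /le_trans; apply.
rewrite /C0 -/n -/K.
have -> : A ^+ n * (K * (A ^+ n * (Dist L * S))) =
  A ^+ n * (K * (A ^+ n * Dist L)) * S by rewrite !mulrA.
by move: (A ^+ n * _) => P; clear - S0; lra.
Qed.
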